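(* Let $\mathbb{K}$ be an algebraically closed field of characteristic $0$, $R=\mathbb{K}[\mathbf t,\mathbf x]=\mathbb{K}[t_1,\dots,t_d,x_1,\dots,x_{n-d}]$, and let $I\subseteq R$ be a primary ideal of dimension $d$ for which $\mathbf t$ is a set of independent variables. Let $\{N_1,\dots,N_m\}$ be a minimal set of Noetherian operators for $I$ of the form $N_i=\sum_\alpha f_{\alpha,i}(\mathbf t,\mathbf x)\partial_{\mathbf x}^\alpha$ with $f_{\alpha,i}\in R$ (involving only $\partial_{\mathbf x}$). Let $(\mathbf t_0,\mathbf x_0)\in\mathbb{V}(I)$. If $\mathbf t_0$ is general, then $$\operatorname{span}_{\mathbb{K}}\{N_1(\mathbf t_0,\mathbf x_0),\dots,N_m(\mathbf t_0,\mathbf x_0)\}=D_{\mathfrak m_{(\mathbf t_0,\mathbf x_0)}}[I+(\mathbf t-\mathbf t_0)].$$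
   Context: Independent variables: $t_1,\dots,t_d$ are algebraically independent in $R/I$. A set $N$ of operators in the Weyl algebra $R\langle\partial_{\mathbf t},\partial_{\mathbf x}\rangle$ is a set of Noetherian operators for $I$ if for all $f\in R$: $f\in I\iff D\bullet f\in\sqrt I$ for all $D\in N$; minimal means no proper subset has this property. The specialization is $N_i(\mathbf t_0,\mathbf x_0)=\sum_\alpha f_{\alpha,i}(\mathbf t_0,\mathbf x_0)\partial_{\mathbf x}^\alpha\in\mathbb{K}[\partial_{\mathbf x}]$. For a point $q\in\mathbb{K}^n$ with maximal ideal $\mathfrak m_q$ and an ideal $J\subseteq R$, $D_{\mathfrak m_q}[J]=\{D\in\mathbb{K}[\partial_{\mathbf t},\partial_{\mathbf x}]:(D\bullet f)(q)=0\ \forall f\in J\}$. $(\mathbf t-\mathbf t_0)$ denotes the ideal $(t_1-t_{0,1},\dots,t_d-t_{0,d})$. ''General'' means for $\mathbf t_0$ outside some proper Zariski-closed subset of $\mathbb{K}^d$. *)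

(* Defs.v *)
From HB Require Import structures.
From mathcomp Require Import all_boot all_order all_algebra.
From mathcomp Require Import mpoly.
Set Implicit Arguments. Unset Strict Implicit. Unset Printing Implicit Defensive.
Import GRing.Theory.
Local Open Scope ring_scope.

(* Conventions: R = K[t_1..t_d, x_1..x_e] is {mpoly K[d + e]}; variable
   lshift e i is t_i, variable rshift d j is x_j (so n = d + e).
   Ideals are represented by predicates (Prop-valued) on the ring. *)

Section Ideals.
Variables (K : fieldType) (n : nat).
Local Notation Rg := {mpoly K[n]}.

Definition is_ideal (I : Rg -> Prop) : Prop :=
  [/\ I 0, (forall f g, I f -> I g -> I (f + g)) & (forall f g, I g -> I (f * g))].

Definition radical (I : Rg -> Prop) (f : Rg) : Prop := exists k : nat, I (f ^+ k).

Definition prime_ideal (P : Rg -> Prop) : Prop :=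
  [/\ is_ideal P, ~ P 1 & forall f g, P (f * g) -> P f \/ P g].

Definition primary_ideal (I : Rg -> Prop) : Prop :=
  [/\ is_ideal I, ~ I 1 & forall f g, I (f * g) -> I f \/ radical I g].

Definition prime_chain_over (I : Rg -> Prop) (k : nat) (c : nat -> Rg -> Prop) : Prop :=
  [/\ (forall i, (i <= k)%N -> prime_ideal (c i)),
      (forall f, I f -> c 0%N f),
      (forall i, (i < k)%N -> forall f, c i f -> c i.+1 f) &
      (forall i, (i < k)%N -> exists f, c i.+1 f /\ ~ c i f)].

Definition krull_dim_eq (I : Rg -> Prop) (k : nat) : Prop :=
  (exists c, prime_chain_over I k c) /\ ~ (exists c, prime_chain_over I k.+1 c).

Definition in_variety (I : Rg -> Prop) (q : 'I_n -> K) : Prop :=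
  forall f, I f -> f.@[q] = 0.

(* constant-coefficient differential operator D = sum_a c_a d^a in K[d_1..d_n]
   (represented as a polynomial in the d's) applied to f *)
Definition capply (D f : Rg) : Rg :=
  \sum_(m <- msupp D) D@_m *: mderivm m f.

Definition Dmq (q : 'I_n -> K) (J : Rg -> Prop) (D : Rg) : Prop :=
  forall f, J f -> (capply D f).@[q] = 0.
End Ideals.

Section TX.
Variables (K : fieldType) (d e : nat).
Local Notation Rg := {mpoly K[d + e]}.

Definition tvar (i : 'I_d) : Rg := 'X_(lshift e i).
Definition xvar (j : 'I_e) : Rg := 'X_(rshift d j).

Definition t_independent (I : Rg -> Prop) : Prop :=
  forall p : {mpoly K[d]}, I (p \mPo [tuple tvar i | i < d]) -> p = 0.

Definition pt (t0 : 'I_d -> K) (x0 : 'I_e -> K) : 'I_(d + e) -> K :=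
  fun i => match split i with inl j => t0 j | inr j => x0 j end.

Definition add_t_ideal (I : Rg -> Prop) (t0 : 'I_d -> K) (f : Rg) : Prop :=
  exists (a : Rg) (b : 'I_d -> Rg),
    I a /\ f = a + \sum_(i < d) b i * (tvar i - (t0 i)%:MP).

Definition xmon (m : 'X_{1..e}) : 'X_{1..d + e} :=
  [multinom (match split i with inl _ => 0%N | inr j => m j end) | i < d + e].

(* operators N = sum_alpha f_alpha(t,x) d_x^alpha with f_alpha in R; the
   coefficient of the monomial alpha is f_alpha *)
Definition xop := {mpoly {mpoly K[d + e]}[e]}.

Definition xapply (N : xop) (f : Rg) : Rg :=
  \sum_(m <- msupp N) N@_m * mderivm (xmon m) f.

Definition noetherian_family (I : Rg -> Prop) (k : nat) (S : 'I_k -> Prop)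
  (N : 'I_k -> xop) : Prop :=
  forall f : Rg, I f <-> (forall i, S i -> radical I (xapply (N i) f)).

(* {N_1..N_k} is a set of Noetherian operators and no proper subset of the
   set {N_1..N_k} is one *)
Definition minimal_noetherian (I : Rg -> Prop) (k : nat) (N : 'I_k -> xop) : Prop :=
  noetherian_family I (fun _ => True) N /\
  forall S : 'I_k -> Prop,
    (exists i, forall j, S j -> N j <> N i) -> ~ noetherian_family I S N.

Definition specialize (N : xop) (q : 'I_(d + e) -> K) : {mpoly K[e]} :=
  \sum_(m <- msupp N) (N@_m).@[q] *: 'X_[m].

(* inclusion K[d_x] -> K[d_t, d_x] *)
Definition embx (P : {mpoly K[e]}) : Rg := P \mPo [tuple xvar j | j < e].
End TX.

(* Main.v *)
(** Let P be the radical of I and kappa the residue field of P. If some x_j were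
transcendental over K(t) in kappa, primes could be climbed one at a time along an
independent set of d + 1 variables, contradicting dim I = d; so kappa is algebraic,
hence separable, over K(t), and every element outside P divides some nonzero g(t)
modulo P. Separability gives p_j(t, x_j) in P whose derivative is not in P, and these
p_j serve as local coordinates: modulo P and up to powers of one g(t), an element of
R has arbitrarily prescribed x-derivatives up to any order. Thus, once a maximal
kappa-independent subfamily of the N_i is chosen, f |-> (N_i f mod P) hits every
vector up to a factor h(t).

The inclusion of the span in D[I + (t - t0)] is immediate. Conversely, an element of
D[I + (t - t0)] has no d_t; if it is not in the span, some polynomial f has N_i f
vanishing at q for all i but D f not. For general t0 the fibre of P over t0 is
reduced at q, so after multiplying f by a polynomial that is 1 to high order at q
one gets N_i f in P + (t - t0). Lifting the coefficients of the t_j - t0_j through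
the map above corrects h f by an element of (t - t0) into I, whence D f (q) = 0. *)

Require Import Defs.
From HB Require Import structures.
From mathcomp Require Import all_boot all_order all_algebra.
From mathcomp Require Import mpoly.
From mathcomp Require Import ssrcomplements ring_quotient generic_quotient fraction.
From mathcomp Require Import ring zify.
From mathcomp Require boolp classical_sets.
Import GRing.Theory.
Local Open Scope ring_scope.
Set Implicit Arguments. Unset Strict Implicit. Unset Printing Implicit Defensive.

(** * Residue field of a prime ideal *)

Section ResidueField.
Variables (R : comNzRingType) (P : R -> Prop).
Hypotheses (P0 : P 0) (PD : forall f g, P f -> P g -> P (f + g))
  (PM : forall f g, P g -> P (f * g)) (P1 : ~ P 1)
  (Pprime : forall f g, P (f * g) -> P f \/ P g).

(** Membership in [P] is decided classically, since the quotient construction takes a Boolean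
    predicate. *)
Let Pb : {pred R} := fun f => boolp.asbool (P f).

Let Pb_idealr : idealr_closed Pb.
Proof.
split.
- by rewrite unfold_in; apply/boolp.asboolP.
- by rewrite unfold_in; apply/negP => /boolp.asboolP.
move=> a u v; rewrite !unfold_in => /boolp.asboolP Pu /boolp.asboolP Pv.
by apply/boolp.asboolP; apply: PD => //; apply: PM.
Qed.

HB.instance Definition _ := isIdealr.Build R Pb Pb_idealr.

Definition prime_quot := {ideal_quot Pb}.
HB.instance Definition _ := GRing.ComNzRing.on prime_quot.

Definition to_quot (f : R) : prime_quot := (\pi_({ideal_quot Pb}) f)%qT.

Lemma to_quotE f g : to_quot f = to_quot g <-> P (f - g).
Proof.
rewrite /to_quot; split => [/eqP|Pfg].
  by rewrite -Quotient.idealrBE unfold_in => /boolp.asboolP.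
by apply/eqP; rewrite -Quotient.idealrBE unfold_in; apply/boolp.asboolP.
Qed.

Lemma to_quot_is_zmod : zmod_morphism to_quot.
Proof. by move=> x y; rewrite /to_quot raddfB. Qed.
Lemma to_quot_is_monoid : monoid_morphism to_quot.
Proof.
split; first by rewrite /to_quot rmorph1.
by move=> x y; rewrite /to_quot rmorphM.
Qed.
HB.instance Definition _ := GRing.isZmodMorphism.Build R prime_quot to_quot to_quot_is_zmod.
HB.instance Definition _ := GRing.isMonoidMorphism.Build R prime_quot to_quot to_quot_is_monoid.

Lemma to_quot_surj z : exists f, z = to_quot f.
Proof. by exists (repr (z : {ideal_quot Pb})); rewrite /to_quot reprK. Qed.

Lemma to_quot_eq0 f : to_quot f = 0 <-> P f.
Proof. by rewrite -(rmorph0 to_quot) to_quotE subr0. Qed.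

(** The fraction field is formed over an integral domain equipped with a total inverse map; inverses
    are chosen classically and non-units are left fixed. *)
Definition quot_unit : pred prime_quot :=
  fun x => boolp.asbool (exists y, y * x = 1).
Definition quot_inv (x : prime_quot) : prime_quot :=
  if boolp.pselect (exists y, y * x = 1) is left h then projT1 (boolp.cid h)
  else x.

Fact quot_mulVx : {in quot_unit, left_inverse 1 quot_inv *%R}.
Proof.
move=> x; rewrite unfold_in => /boolp.asboolP h.
by rewrite /quot_inv; case: boolp.pselect => // h'; case: boolp.cid.
Qed.
Fact quot_unitPl : forall x y : prime_quot, y * x = 1 -> quot_unit x.
Proof. by move=> x y h; apply/boolp.asboolP; exists y. Qed.
Fact quot_inv_out : {in [predC quot_unit], quot_inv =1 id}.
Proof.
move=> x; rewrite inE unfold_in => /boolp.asboolP h.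
by rewrite /quot_inv; case: boolp.pselect.
Qed.
HB.instance Definition _ := GRing.ComNzRing_hasMulInverse.Build prime_quot
  quot_mulVx quot_unitPl quot_inv_out.

Fact quot_integral (x y : prime_quot) : x * y = 0 -> (x == 0) || (y == 0).
Proof.
have [f ->] := to_quot_surj x; have [g ->] := to_quot_surj y.
rewrite -rmorphM => /to_quot_eq0/Pprime[] /to_quot_eq0 ->; rewrite eqxx //.
by rewrite orbT.
Qed.
HB.instance Definition _ :=
  GRing.ComUnitRing_isIntegral.Build prime_quot quot_integral.

Lemma residue_field : exists (F : fieldType) (pi : {rmorphism R -> F}),
  (forall f, pi f = 0 <-> P f) /\
  (forall z, exists a b, pi b != 0 /\ z = pi a / pi b).
Proof.
exists {fraction prime_quot}, (@tofrac prime_quot \o to_quot); split=> [f|z] /=.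
  by rewrite -to_quot_eq0; split=> [/eqP|->]; rewrite ?rmorph0 // tofrac_eq0 => /eqP.
have [r ->] : exists r : {ratio prime_quot}, z = (\pi_({fraction prime_quot}) r)%qT.
  by exists (repr z); rewrite reprK.
have [a Ea] := to_quot_surj (frac r).1; have [b Eb] := to_quot_surj (frac r).2.
have b0 : tofrac (to_quot b) != 0 by rewrite tofrac_eq0 -Eb denom_ratioP.
exists a, b; split=> //; apply: (canRL (mulfK b0)); rewrite -Ea -Eb.
unlock FracField.tofrac; rewrite -[LHS]FracField.pi_mul; apply/eqmodP.
rewrite /= FracField.equivfE /FracField.mulf.
by rewrite !numden_Ratio ?mulr1 ?mulf_neq0 ?oner_eq0 ?denom_ratioP // mulrC.
Qed.
End ResidueField.

(** * Restriction to a set of variables *)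

Lemma mpoly_ring_ind (K : nzRingType) n (Q : {mpoly K[n]} -> Prop) :
    (forall c, Q c%:MP) -> (forall i, Q 'X_i) ->
    (forall f g, Q f -> Q g -> Q (f + g)) ->
    (forall f g, Q f -> Q g -> Q (f * g)) -> forall f, Q f.
Proof.
move=> QC QX QD QM f; elim/mpolyind: f => [|c m p _ _ Qp]; first exact: QC.
apply: (QD) => //; rewrite -mul_mpolyC; apply: (QM) => //.
rewrite mpolyXE_id; elim/big_ind: _ => [||i _]; [exact: QC|exact: QM|].
by elim: (m i) => [|k IH]; rewrite ?expr0 ?exprS; [exact: QC|exact: QM].
Qed.

Lemma mpoly_rmorph_eq (K S : nzRingType) n (f g : {rmorphism {mpoly K[n]} -> S}) :
  (forall c, f c%:MP = g c%:MP) -> (forall i, f 'X_i = g 'X_i) -> f =1 g.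
Proof.
move=> fgC fgX; elim/mpoly_ring_ind => // p q IHp IHq.
  by rewrite !rmorphD IHp IHq.
by rewrite !rmorphM IHp IHq.
Qed.

Section Restriction.
Variables (K : comNzRingType) (n : nat).
Local Notation Rg := {mpoly K[n]}.
Implicit Types (S T : {set 'I_n}) (f g h : Rg).

(* The retraction onto K[X_i, i in T]; [restr T f = f] says that f involves only
   the variables in T. *)
Definition restr T : Rg -> Rg :=
  mmap (@mpolyC n K) (fun i => if i \in T then 'X_i else 0).
HB.instance Definition _ T := GRing.RMorphism.on (restr T).

Lemma restrC T c : restr T c%:MP = c%:MP.
Proof. by rewrite /restr mmapC. Qed.

Lemma restrX T i : restr T 'X_i = if i \in T then 'X_i else 0.
Proof. by rewrite /restr mmapX mmap1U. Qed.

Lemma restr_restr S T f : restr S (restr T f) = restr (S :&: T) f.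
Proof.
apply: (mpoly_rmorph_eq (f := restr S \o restr T)) => [c|i] /=.
  by rewrite !restrC.
by rewrite !restrX inE; case: (i \in T); rewrite ?rmorph0 ?restrX ?andbT ?andbF.
Qed.

Lemma restr_idem T f : restr T (restr T f) = restr T f.
Proof. by rewrite restr_restr setIid. Qed.

Lemma restr_sub S T f : S \subset T -> restr S f = f -> restr T f = f.
Proof. by move=> sST fS; rewrite -fS restr_restr (setIidPr sST). Qed.

(* f as a univariate polynomial in X_j. *)
Definition uni (j : 'I_n) : Rg -> {poly Rg} :=
  mmap (polyC \o @mpolyC n K) (fun i => if i == j then 'X else ('X_i)%:P).
HB.instance Definition _ j := GRing.RMorphism.on (uni j).

Lemma uniC j c : uni j c%:MP = (c%:MP)%:P.
Proof. by rewrite /uni mmapC. Qed.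

Lemma uniX j i : uni j 'X_i = if i == j then 'X else ('X_i)%:P.
Proof. by rewrite /uni mmapX mmap1U. Qed.

Lemma uniK j f : (uni j f).['X_j] = f.
Proof.
apply: (mpoly_rmorph_eq (f := horner_eval 'X_j \o uni j) (g := idfun)) => [c|i] /=.
  by rewrite /horner_eval uniC hornerC.
by rewrite /horner_eval uniX; case: eqP => [->|_]; rewrite ?hornerX ?hornerC.
Qed.

(** A polynomial in the variables of [j |: T] thus has, when read in [X_j], coefficients involving
    only [T :\ j]. *)
Lemma map_uni T j f : map_poly (restr (T :\ j)) (uni j f) = uni j (restr (j |: T) f).
Proof.
apply: (mpoly_rmorph_eq (f := map_poly (restr (T :\ j)) \o uni j)
                        (g := uni j \o restr (j |: T))) => [c|i] /=.
  by rewrite !restrC !uniC map_polyC /= restrC.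
rewrite uniX restrX !inE; case: eqP => [->|ij] /=.
  by rewrite map_polyX uniX eqxx.
rewrite map_polyC /= restrX !inE; move/eqP: ij => /[dup] ij ->.
by case: ifP => _; rewrite ?rmorph0 // uniX (negPf ij).
Qed.

Lemma uni_neq0 j f : f != 0 -> uni j f != 0.
Proof. by apply: contraNneq => f0; rewrite -(uniK j f) f0 horner0. Qed.

End Restriction.

(** * Independent variables and integrality *)

Section Independence.
Variables (K : fieldType) (n : nat) (F : fieldType).
Local Notation Rg := {mpoly K[n]}.
Variable pi : {rmorphism Rg -> F}.
Implicit Types (S T : {set 'I_n}) (f g h : Rg).

Definition indep T := forall f, restr T f = f -> pi f = 0 -> f = 0.

Lemma dep_relation T j : j \notin T -> ~ indep (j |: T) ->
  exists p : {poly Rg}, [/\ p != 0, map_poly (restr T) p = p &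
     (map_poly pi p).[pi 'X_j] = 0].
Proof.
move=> jT /boolp.existsNP[f] /boolp.not_implyP[fT] /boolp.not_implyP[pf0 /eqP f0].
exists (uni j f); split; first exact: uni_neq0.
  have {1}-> : T = T :\ j by apply/esym/setDidPl; rewrite disjoint_sym disjoints1.
  by rewrite map_uni fT.
by rewrite horner_map /= uniK.
Qed.

(** Multiplying p(z) = 0 by a^(s-1), with a the leading coefficient and s the degree of p, gives a
    monic equation for a z. *)
Lemma integral_lead T (p : {poly Rg}) z : indep T -> p != 0 ->
  map_poly (restr T) p = p -> (map_poly pi p).[z] = 0 ->
  integralOver (pi \o restr T) (pi (lead_coef p) * z).
Proof.
move=> iT p0 pT pz; set a := lead_coef p; set s := (size p).-1.
have co k : restr T p`_k = p`_k by rewrite -{2}pT coef_map.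
have aT : restr T a = a by rewrite /a lead_coefE co.
have sp : size p = s.+1 by rewrite /s prednK // size_poly_gt0.
set r : {poly Rg} := \poly_(k < s) (a ^+ (s.-1 - k) * p`_k).
have szr : (size r <= s)%N by exact: size_poly.
have pzE : \sum_(k < s) pi p`_k * z ^+ k + pi a * z ^+ s = 0.
  rewrite -[RHS]pz (horner_coef_wide (n := s.+1)) -?sp ?size_poly // sp big_ord_recr /=.
  by rewrite coef_map /a lead_coefE; congr (_ + _); apply: eq_bigr => k _; rewrite coef_map.
(* A constant [p] would put its nonzero leading coefficient in the kernel of [pi], against
   independence. *)
have s0 : s != 0%N.
  apply: contra_neqN p0 => /eqP s0; apply/eqP; rewrite -lead_coef_eq0; apply/eqP/iT => //.
  by move: pzE; rewrite s0 big_ord0 add0r expr0 mulr1.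
exists ('X^s + r); first by rewrite monicE lead_coefDl ?lead_coefXn // size_polyXn.
rewrite rootE rmorphD /= map_polyXn hornerD hornerXn; apply/eqP.
rewrite (horner_coef_wide (n := s)); last by rewrite (leq_trans (size_poly _ _)).
transitivity (pi a ^+ s.-1 * (\sum_(k < s) pi p`_k * z ^+ k + pi a * z ^+ s)); last first.
  by rewrite pzE mulr0.
rewrite mulrDr mulrA -exprSr prednK ?lt0n // -exprMn addrC mulr_sumr.
congr (_ + _); apply: eq_bigr => k _; rewrite coef_map coef_poly ltn_ord /=.
have -> : s.-1 = (s.-1 - k + k)%N by rewrite subnK // -ltnS prednK ?lt0n.
by rewrite addnK !rmorphM !rmorphXn /= aT co exprD exprMn; ring.
Qed.

Definition max_indep T := indep T /\ forall j, j \notin T -> ~ indep (j |: T).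

Lemma integral_restr T f : integralOver (pi \o restr T) (pi (restr T f)).
Proof. exact: (integral_id (pi \o restr T) f). Qed.

(** [g] is the product of the leading coefficients of algebraic relations for the [X_j] outside [T].
    It makes every variable integral, and adding exponents carries this to sums and products. *)
Lemma max_indep_integral T : max_indep T -> exists g, [/\ restr T g = g, g != 0 &
  forall h, exists k, integralOver (pi \o restr T) (pi (g ^+ k * h))].
Proof.
case=> iT maxT.
have /boolp.choice[a aP] : forall j, exists a, [/\ restr T a = a, a != 0 &
    integralOver (pi \o restr T) (pi (a * 'X_j))].
  move=> j; have [jT|jT] := boolP (j \in T).
    exists 1; rewrite rmorph1 oner_eq0; split=> //.
    by have := integral_restr T 'X_j; rewrite restrX jT mul1r.
  have [p [p0 pT pj]] := dep_relation jT (maxT _ jT).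
  exists (lead_coef p); rewrite lead_coef_eq0 p0 rmorphM; split=> //.
    have co k : restr T p`_k = p`_k by rewrite -{2}pT coef_map.
    by rewrite lead_coefE co.
  exact: integral_lead.
exists (\prod_j a j); have aT j : restr T (a j) = a j by case: (aP j).
split; first by rewrite rmorph_prod; apply: eq_bigr => i _; apply: aT.
  by apply/prodf_neq0 => j _; case: (aP j).
set g := \prod_j a j.
have gT : restr T g = g by rewrite rmorph_prod; apply: eq_bigr => i _; apply: aT.
have ig k : integralOver (pi \o restr T) (pi (g ^+ k)).
  by rewrite -gT -rmorphXn; apply: integral_restr.
elim/mpoly_ring_ind => [c|j|f h [k kP] [l lP]|f h [k kP] [l lP]].
- by exists 0%N; rewrite mul1r -(restrC T); apply: integral_restr.
- exists 1%N; rewrite expr1 /g (bigD1 j) //= mulrAC rmorphM.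
  apply: integral_mul; first by case: (aP j).
  have <- : restr T (\prod_(i < n | i != j) a i) = \prod_(i < n | i != j) a i.
    by rewrite rmorph_prod; apply: eq_bigr => i _; apply: aT.
  exact: integral_restr.
- exists (k + l)%N.
  have -> : g ^+ (k + l) * (f + h) = g ^+ l * (g ^+ k * f) + g ^+ k * (g ^+ l * h).
    by rewrite exprD; ring.
  by rewrite rmorphD; apply: integral_add; rewrite rmorphM; apply: integral_mul.
- exists (k + l)%N; rewrite exprD mulrACA rmorphM.
  exact: integral_mul.
Qed.

(** Some multiple [y] of [h] satisfies a monic equation over the polynomials in [T]. Its lowest
    coefficient not killed by [pi] is, after a power of [y] is cancelled, a multiple of [y] modulo
    the kernel. *)
Lemma max_indep_denominator T h : max_indep T -> pi h != 0 ->
  exists g h', [/\ restr T g = g, g != 0 & pi (h * h') = pi g].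
Proof.
move=> mT h0; have [g0 [g0T g00 /(_ h)[k]]] := max_indep_integral mT.
have [iT _] := mT; set y := g0 ^+ k * h => - [p pm /rootP py].
have y0 : pi y != 0.
  rewrite rmorphM mulf_neq0 // rmorphXn expf_neq0 //.
  by apply: contra_neq g00; apply: iT.
have {pm} p0 : map_poly (pi \o restr T) p != 0 by apply: monic_neq0; apply: monic_map.
suff: exists g u, [/\ restr T g = g, g != 0 & pi g = pi y * pi u].
  case=> g [u [gT g0' gE]]; exists g, (g0 ^+ k * u); split=> //.
  by rewrite gE -rmorphM; congr (pi _); rewrite /y; ring.
elim/poly_ind: p py p0 => [|p c IH]; first by rewrite rmorph0 eqxx.
rewrite rmorphD rmorphM /= map_polyX map_polyC /= hornerD hornerMX hornerC.
(* A vanishing constant term lets the nonzero factor [pi y] be cancelled; a nonvanishing one is the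
   denominator sought. *)
have [c0|c0] := eqVneq (pi (restr T c)) 0.
  rewrite c0 addr0 => /eqP; rewrite mulf_eq0 (negPf y0) orbF => /eqP /IH + p0.
  by apply; apply: contraNneq p0 => ->; rewrite mul0r polyC0 addr0.
move=> /eqP; rewrite addr_eq0 => /eqP pc _.
exists (restr T c), (- (map_poly (restr T) p).[y]); split; first exact: restr_idem.
  by apply: contraNneq c0 => ->; rewrite rmorph0.
by rewrite rmorphN /= -horner_map -map_poly_comp mulrN mulrC pc opprK.
Qed.

End Independence.

(** * Chains of primes above an independent set of variables *)

(** Zorn's lemma gives an ideal maximal among those containing [J] and disjoint from the
    multiplicative set [M]; such an ideal is prime. *)
Lemma prime_ideal_avoiding (K : fieldType) n (J M : {mpoly K[n]} -> Prop) :
    is_ideal J -> M 1 -> (forall f g, M f -> M g -> M (f * g)) ->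
    (forall f, J f -> ~ M f) ->
  exists Q, [/\ prime_ideal Q, (forall f, J f -> Q f) & forall f, Q f -> ~ M f].
Proof.
move=> iJ M1 MM JM.
pose good A := [/\ is_ideal A, (forall f, J f -> A f) & forall f, A f -> ~ M f].
have [|A [PA Amax]] := @classical_sets.Zorn_bigcup {mpoly K[n]}
    (fun A => (forall f, ~ A f) \/ good A).
  move=> C CP Ctot.
  have Cgood X f : C X -> X f -> good X by case/CP => // X0 /X0.
  have [[X0 CX0 [f0 Xf0]]|C0] := boolp.pselect (exists2 X, C X & exists f, X f); last first.
    by left=> f [X CX Xf]; apply: C0; exists X => //; exists f.
  have [i0 J0 _] := Cgood _ _ CX0 Xf0; right; split.
  - split=> [|f g [X CX Xf] [Y CY Yg]|f g [X CX Xg]].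
    + by exists X0 => //; case: i0.
    + have [[_ XD _] _ _] := Cgood _ _ CX Xf; have [[_ YD _] _ _] := Cgood _ _ CY Yg.
      have [XY|YX] := Ctot _ _ CX CY; [exists Y|exists X] => //.
        by apply: YD => //; apply: XY.
      by apply: XD => //; apply: YX.
    + by have [[_ _ XM] _ _] := Cgood _ _ CX Xg; exists X => //; apply: XM.
  - by move=> f /J0; exists X0.
  - by move=> f [X CX Xf]; case: (Cgood _ _ CX Xf) => _ _; apply.
have gJ : good J by split.
have gA : good A.
  case: PA => // A0; have [] := Amax J; last by right.
  by split=> [f /A0 //|/(_ 0)]; case: iJ => J0 _ _ /(_ J0) /A0.
have [[A0 AD AM] JA MA] := gA; exists A; split=> //; split=> //.
  by move=> /MA.
move=> f g Afg; apply: boolp.contrapT => /boolp.not_orP[Af Ag].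
(* By maximality, adjoining an element outside [A] produces a member of [M]. Doing so for [f] and
   for [g], the product of the two members lies both in [M] and in [A]. *)
have meet h : ~ A h -> exists a k, A a /\ M (a + k * h).
  move=> Ah; apply: boolp.contrapT => noM; apply: (Amax (fun u => exists a k, A a /\ u = a + k * h)).
    split=> [a Aa|/(_ h) sub]; first by exists a, 0; rewrite mul0r addr0.
    by apply/Ah/sub; exists 0, 1; rewrite mul1r add0r.
  right; split=> [||u [a [k [Aa ->]]] Mu]; last by apply: noM; exists a, k.
    split=> [|u v [a [k [Aa ->]]] [b [l [Ab ->]]]|u v [a [k [Aa ->]]]].
    - by exists 0, 0; rewrite mul0r addr0.
    - by exists (a + b), (k + l); split; [exact: AD|ring].
    - by exists (u * a), (u * k); split; [exact: AM|ring].
  by move=> a /JA Aa; exists a, 0; rewrite mul0r addr0.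
have [a [k [Aa Ma]]] := meet _ Af; have [b [l [Ab Mb]]] := meet _ Ag.
apply: MA (MM _ _ Ma Mb).
have -> : (a + k * f) * (b + l * g) = (b + l * g) * a + (k * f * b + k * l * (f * g)) by ring.
by apply: (AD); [exact: AM|apply: (AD); apply: AM].
Qed.

Lemma prime_residue_field (K : fieldType) n (P : {mpoly K[n]} -> Prop) :
  prime_ideal P -> exists (F : fieldType) (pi : {rmorphism {mpoly K[n]} -> F}),
    (forall f, pi f = 0 <-> P f) /\
    (forall z, exists a b, pi b != 0 /\ z = pi a / pi b).
Proof. by case=> -[P0 PD PM] P1 Pp; exact: residue_field. Qed.

Lemma natr_inj (K : fieldType) : [pchar K] =i pred0 ->
  injective (fun i : nat => i%:R : K).
Proof.
move=> /pcharf0P K0 i j /= ij; wlog leij : i j ij / (i <= j)%N.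
  by move=> W; case/orP: (leq_total i j) => [|] /W -> //.
apply/eqP; rewrite eqn_leq leij /= -subn_eq0 -K0 natrB // ij subrr //.
Qed.

(** Characteristic 0 supplies [size p] distinct constants, more than a nonzero [p] has roots. *)
Lemma poly_nonroot (K : fieldType) n (p : {poly {mpoly K[n]}}) :
  [pchar K] =i pred0 -> p != 0 -> exists c : K, p.[c%:MP] != 0.
Proof.
move=> K0 p0; apply: boolp.contrapT => noc.
pose rs := [seq (i%:R : K)%:MP_[n] | i <- iota 0 (size p)].
suff: (size rs < size p)%N by rewrite size_map size_iota ltnn.
apply: max_poly_roots => //.
  apply/allP => _ /mapP[i _ ->]; apply/negPn/negP => nr; apply: noc.
  by exists i%:R; rewrite -rootE.
rewrite map_inj_uniq ?iota_uniq // => i j /eqP; rewrite mpolyC_eq => /eqP ij.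
exact: natr_inj ij.
Qed.

Lemma max_indep_exists (K : fieldType) n (F : fieldType)
    (pi : {rmorphism {mpoly K[n]} -> F}) (T : {set 'I_n}) :
  indep pi T -> exists2 T' : {set 'I_n}, T \subset T' & max_indep pi T'.
Proof.
move=> iT; have [|T' /maxsetP[iT' T'max] sTT'] :=
    @maxset_exists _ (fun T => boolp.asbool (indep pi T)) T.
  exact/boolp.asboolP.
exists T' => //; split; first exact/boolp.asboolP.
move=> j jT' /boolp.asboolP ij; have := T'max _ ij (subsetUr _ _).
by move=> eT'; move: jT'; rewrite -eT' !inE eqxx.
Qed.

Definition indep_mod (K : fieldType) n (P : {mpoly K[n]} -> Prop) (T : {set 'I_n}) :=
  forall f, restr T f = f -> P f -> f = 0.

Section Chain.
Variables (K : fieldType) (n : nat).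
Hypothesis K0 : [pchar K] =i pred0.
Local Notation Rg := {mpoly K[n]}.
Implicit Types (P : Rg -> Prop) (T : {set 'I_n}).

(** The variety is cut by a hyperplane [X_i = c] on which the denominator [g] of integrality does
    not vanish identically. The kernel of [pi] together with [X_i - c] then generates no nonzero
    polynomial in [T :\ i], so a prime above it can avoid all of these. *)
Lemma prime_step_max (F : fieldType) (pi : {rmorphism Rg -> F}) T i :
    max_indep pi T -> i \in T ->
  exists Q, [/\ prime_ideal Q, (forall f, pi f = 0 -> Q f),
    (exists f, Q f /\ pi f <> 0) & indep_mod Q (T :\ i)].
Proof.
move=> mT iT; have [indT _] := mT; have [g [gT g0 gint]] := max_indep_integral mT.
have [c gc] := poly_nonroot K0 (uni_neq0 i g0).
set b : Rg := 'X_i - c%:MP.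
have bT : restr T b = b by rewrite rmorphB /= restrX restrC iT.
have ub (f : Rg) : (uni i (f * b)).[c%:MP] = 0.
  by rewrite rmorphM rmorphB /= uniX uniC eqxx hornerM hornerXsubC subrr mulr0.
pose J (f : Rg) := exists a h, pi a = 0 /\ f = a + h * b.
pose M (f : Rg) := restr (T :\ i) f = f /\ f != 0.
have uT (f : Rg) : restr (T :\ i) f = f -> uni i f = f%:P.
  move=> fT; rewrite -fT.
  elim/mpoly_ring_ind: f {fT} => [d|j|p q IHp IHq|p q IHp IHq].
  - by rewrite !restrC uniC.
  - rewrite restrX !inE; case: eqP => [_|/eqP /negPf ji] /=; last case: ifP => _;
      by rewrite ?rmorph0 // uniX ji.
  - by rewrite !rmorphD /= IHp IHq.
  - by rewrite !rmorphM /= IHp IHq.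
have [||||Q [Qp JQ QM]] := @prime_ideal_avoiding K n J M.
- split=> [|f h [a [u [a0 ->]]] [a' [u' [a'0 ->]]]|f h [a [u [a0 ->]]]].
  + by exists 0, 0; rewrite rmorph0 mul0r addr0.
  + by exists (a + a'), (u + u'); rewrite rmorphD a0 a'0 addr0; split=> //; ring.
  + by exists (f * a), (f * u); rewrite rmorphM a0 mulr0; split=> //; ring.
- by split; rewrite ?rmorph1 ?oner_eq0.
- move=> f h [fT f0] [hT h0]; split; last exact: mulf_neq0.
  by rewrite rmorphM /= fT hT.
- move=> m [a [h [a0 mE]]] [mT' m0].
  have [k [p pm /rootP hp]] := gint h.
  have mTT : restr T m = m by apply: restr_sub mT'; apply: subD1set.
  pose s := (size p).-1.
  have sp : size p = s.+1 by rewrite prednK // size_poly_gt0 monic_neq0.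
  (* [w] is the integral equation of [g ^+ k * h] multiplied by [b ^+ s], rewritten through
     [pi m = pi h * pi b]. Independence gives [w = 0]; at [X_i = c] the factor [b] vanishes, and
     only the top term (g(c)^k m)^s remains. *)
  pose w := \sum_(l < s.+1) restr T p`_l * b ^+ (s - l) * (g ^+ k * m) ^+ l.
  have w0 : w = 0.
    apply: indT.
      rewrite rmorph_sum; apply: eq_bigr => l _.
      by rewrite !(rmorphM, rmorphXn) /= restr_idem bT gT mTT.
    transitivity (pi b ^+ s * (map_poly (pi \o restr T) p).[pi (g ^+ k * h)]); last first.
      by rewrite hp mulr0.
    rewrite (horner_coef_wide (n := s.+1)); last by rewrite -sp size_poly.
    rewrite rmorph_sum mulr_sumr; apply: eq_bigr => -[l /= ls] _.
    rewrite coef_map_id0; last by rewrite /= !rmorph0.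
    have pmE : pi m = pi h * pi b by rewrite mE rmorphD a0 add0r rmorphM.
    rewrite !(rmorphM, rmorphXn) /= pmE !exprMn.
    by rewrite -{2}(subnK (n := s) (m := l)) // exprD; ring.
  have ug : (uni i w).[c%:MP] = ((uni i g).[c%:MP] ^+ k * m) ^+ s.
    rewrite /w big_ord_recr rmorphD /= hornerD rmorph_sum horner_sum big1 ?add0r => [|l _].
      have -> : p`_s = 1 by move: pm; rewrite monicE lead_coefE => /eqP.
      rewrite rmorph1 subnn expr0 !mul1r !(rmorphM, rmorphXn) /= (uT m) //.
      by rewrite !(horner_exp, hornerM, hornerC).
    have -> : (s - l = (s - l).-1.+1)%N by rewrite prednK // subn_gt0.
    rewrite -[RHS](ub (restr T p`_l * b ^+ (s - l).-1 * (g ^+ k * m) ^+ l)) /=.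
    by rewrite exprSr mulrA -!mulrA [b * _]mulrC !mulrA.
  move: ug; rewrite w0 rmorph0 horner0 => /esym/eqP; rewrite expf_eq0 mulf_eq0.
  by rewrite expf_eq0 (negPf gc) (negPf m0) !andbF.
exists Q; split=> //.
- by move=> f f0; apply: JQ; exists f, 0; rewrite mul0r addr0.
- exists b; split; first by apply: JQ; exists 0, 1; rewrite rmorph0 mul1r add0r.
  move=> /(indT _ bT) b0.
  have := congr1 (mcoeff U_(i)%MM) b0.
  by rewrite mcoeffB mcoeffX mcoeffC mcoeff0 eqxx mnm1_eq0 mulr0 subr0 => /eqP; rewrite oner_eq0.
- by move=> f fT Qf; apply/eqP/negPn/negP => f0; case: (QM _ Qf).
Qed.

(** Each step gives up one variable of [T]. For the step, [T] is enlarged to a maximal independent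
    [S]; the new prime keeps [S :\ i], hence [T :\ i], independent. *)
Lemma prime_chain_from P T : prime_ideal P -> indep_mod P T ->
  exists c, prime_chain_over P #|T| c /\ c 0%N = P.
Proof.
move: {2}#|T| (erefl #|T|) => r; elim: r P T => [|r IH] P T cT Pp iT.
  by rewrite cT; exists (fun=> P); split=> //; split.
have [i iT'] : exists i, i \in T by apply/card_gt0P; rewrite cT.
have [F [pi [piP _]]] := prime_residue_field Pp.
have ipi : indep pi T by move=> f fT /piP; apply: iT.
have [S sTS mS] := max_indep_exists ipi.
have [Q [Qp PQ [f [Qf pf]] iQ]] := prime_step_max mS (subsetP sTS _ iT').
have iQT : indep_mod Q (T :\ i).
  by move=> h hT; apply: iQ; apply: restr_sub hT; apply: setSD.
have cTi : #|T :\ i| = r by move: (cardsD1 i T); rewrite cT iT' => -[].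
have [c [[cp cQ cs cn] c0]] := IH Q (T :\ i) cTi Qp iQT.
rewrite cTi in cp cs cn.
exists (fun k => if k is k'.+1 then c k' else P); rewrite cT; split=> //; split=> //.
- by case=> //= k kr; apply: cp.
- by case=> [_ h Ph|k kr]; [rewrite c0; apply/PQ/piP|apply: cs].
- case=> [_|k kr]; last exact: cn.
  by exists f; rewrite c0; split=> // /piP.
Qed.

End Chain.

(** * Prescribing derivatives *)

Section MnmOn.
Variables (n : nat) (A : {set 'I_n}).
Implicit Types (m : 'X_{1..n}).

Definition mnm_on m := [forall i, (i \in A) || (m i == 0%N)].

Lemma mnm_onP m : reflect (forall i, i \notin A -> m i = 0%N) (mnm_on m).
Proof.
apply: (iffP forallP) => [mA i iA|mA i]; first by have := mA i; rewrite (negPf iA) => /eqP.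
by have [//|/mA ->] := boolP (i \in A).
Qed.

Lemma mnm_onU j m : mnm_on (U_(j) + m)%MM = (j \in A) && mnm_on m.
Proof.
apply/mnm_onP/andP => [mA|[jA /mnm_onP mA] i iA].
  split; last by apply/mnm_onP => i /mA; rewrite mnmDE => /eqP; rewrite addn_eq0 => /andP[_ /eqP].
  by apply/negPn/negP => /mA; rewrite mnmDE mnm1E eqxx.
rewrite mnmDE mA // mnm1E addn0; case: eqP => // ji.
by rewrite -ji jA in iA.
Qed.

Lemma mnm_pick m i : m i != 0%N -> m = (U_(i) + (m - U_(i)))%MM.
Proof.
move=> mi; apply/mnmP => j; rewrite mnmDE mnmBE mnm1E subnKC //.
by case: eqP => // <-; rewrite lt0n.
Qed.

Lemma mnm_neq0P m : m != 0%MM -> exists i, m i != 0%N.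
Proof.
move=> m0; apply/existsP; apply: contraNT m0 => /existsPn m0.
by apply/eqP/mnmP => i; rewrite mnm0E; apply/eqP/negPn; apply: m0.
Qed.

Lemma mnm_on_ind (Q : 'X_{1..n} -> Prop) : Q 0%MM ->
    (forall j m, j \in A -> mnm_on m -> Q m -> Q (U_(j) + m)%MM) ->
  forall m, mnm_on m -> Q m.
Proof.
move=> Q0 QU m; move: {2}(mdeg m) (erefl (mdeg m)) => k; elim: k m => [|k IH] m.
  by move=> /eqP; rewrite mdeg_eq0 => /eqP ->.
have [->|/mnm_neq0P[i mi]] := eqVneq m 0%MM; first by rewrite mdeg0.
rewrite (mnm_pick mi) mdegD mdeg1 mnm_onU => -[dm] /andP[iA mA].
by apply: QU => //; apply: IH.
Qed.

End MnmOn.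

(** * Derivatives of monomials in local coordinates *)

Section Derivations.
Variables (K : fieldType) (n : nat).
Local Notation Rg := {mpoly K[n]}.
Implicit Types (m : 'X_{1..n}) (f g h : Rg).

Lemma mderiv1 i : mderiv i (1 : Rg) = 0.
Proof. by rewrite -mpolyC1 mderivC. Qed.

Lemma mderivXn i f k : mderiv i (f ^+ k) = k%:R * f ^+ k.-1 * mderiv i f.
Proof.
elim: k => [|k IH]; first by rewrite expr0 mderiv1 !mul0r.
rewrite exprS mderivM IH; case: k {IH} => [|k] /=; first by rewrite !expr0; ring.
by rewrite exprS; ring.
Qed.

Lemma mderiv_prod_eq0 (J : Type) (r : seq J) (Q : pred J) i (h : J -> Rg) :
  (forall j, Q j -> mderiv i (h j) = 0) -> mderiv i (\prod_(j <- r | Q j) h j) = 0.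
Proof.
move=> h0; elim/big_rec: _ => [|j f Qj f0]; first exact: mderiv1.
by rewrite mderivM h0 // f0 mul0r mulr0 addr0.
Qed.

Lemma mderivmU i m f : mderivm (U_(i) + m)%MM f = mderivm m (mderiv i f).
Proof. by rewrite mderivmDm mderivmU1m. Qed.

Lemma mderivm_const (A : {set 'I_n}) g m f :
  (forall i, i \in A -> mderiv i g = 0) -> mnm_on A m ->
  mderivm m (g * f) = g * mderivm m f.
Proof.
move=> g0 mA; elim/mnm_on_ind: m / mA f => [|j m jA mA IH] f; first by rewrite !mderivm0m.
by rewrite !mderivmU mderivM g0 // mul0r add0r IH.
Qed.

Variables (F : fieldType) (pi : {rmorphism Rg -> F}) (A : {set 'I_n}) (P : 'I_n -> Rg).
Hypotheses (piP : forall i, i \in A -> pi (P i) = 0)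
  (dP : forall i j, i \in A -> j \in A -> i != j -> mderiv j (P i) = 0).

(** Monomials in local coordinates: the [P i] vanish under [pi], and their Jacobian in the
    directions of [A] is diagonal. *)
Definition mpow m : Rg := \prod_i P i ^+ m i.

Let w i := pi (mderiv i (P i)).

(** For [m] supported on [A], the image under [pi] of the m-th derivative of P^m. *)
Definition lead_cst m : F := \prod_i ((m i)`!%:R * w i ^+ m i).

Lemma mpow0 : mpow 0%MM = 1.
Proof. by apply: big1 => i _; rewrite mnm0E expr0. Qed.

Lemma pi_mpow m : mnm_on A m -> m != 0%MM -> pi (mpow m) = 0.
Proof.
move=> /mnm_onP mA /mnm_neq0P[i mi]; have iA : i \in A by apply: contraNT mi => /mA ->.
by rewrite /mpow (bigD1 i) //= rmorphM rmorphXn /= piP // expr0n (negPf mi) mul0r.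
Qed.

Lemma mderiv_mpow j m : j \in A -> mnm_on A m ->
  mderiv j (mpow m) = (m j)%:R * mderiv j (P j) * mpow (m - U_(j))%MM.
Proof.
move=> jA /mnm_onP mA; rewrite /mpow (bigD1 j) //= [in RHS](bigD1 j) //=.
rewrite mderivM [X in _ + _ * X]mderiv_prod_eq0 ?mulr0 ?addr0 => [|i ij].
  rewrite mderivXn mnmBE mnm1E eqxx subn1.
  rewrite [in RHS](eq_bigr (fun i => P i ^+ m i)); first by ring.
  by move=> i ij; rewrite mnmBE mnm1E eq_sym (negPf ij) subn0.
rewrite mderivXn; have [iA|/mA ->] := boolP (i \in A); last by rewrite !mul0r.
by rewrite dP ?mulr0.
Qed.

Lemma lead_cstU j m : lead_cst (U_(j) + m)%MM = (m j).+1%:R * w j * lead_cst m.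
Proof.
rewrite /lead_cst (bigD1 j) //= [in RHS](bigD1 j) //= mnmDE mnm1E eqxx add1n.
rewrite factS natrM exprS [in LHS](eq_bigr (fun i => (m i)`!%:R * w i ^+ m i)); first by ring.
by move=> i ij; rewrite mnmDE mnm1E eq_sym (negPf ij).
Qed.

(* Up to order |a|, the derivatives of c * P^a see only its leading form. *)
Lemma mderivm_mpow b a c : mnm_on A b -> mnm_on A a -> (mdeg b <= mdeg a)%N ->
  pi (mderivm b (c * mpow a)) = (b == a)%:R * lead_cst a * pi c.
Proof.
move=> bA; elim/mnm_on_ind: b / bA a c => [|j b jA bA IH] a c aA ba.
  rewrite mderivm0m rmorphM eq_sym; have [->|a0] := eqVneq a 0%MM.
    rewrite mpow0 rmorph1 mulr1 /lead_cst big1 ?mulr1 ?mul1r // => i _.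
    by rewrite mnm0E expr0 mulr1.
  by rewrite pi_mpow // !mul0r mulr0.
rewrite mderivmU mderivM mderivmD rmorphD mderiv_mpow //.
have b'a : (mdeg b < mdeg a)%N by rewrite mdegD mdeg1 in ba.
(* In the Leibniz rule, the term that differentiates [c] keeps P^a under a derivative of order below
   [mdeg a], so it vanishes. *)
rewrite IH //; last exact: ltnW.
have -> : (b == a) = false by apply: contraTF b'a => /eqP ->; rewrite ltnn.
rewrite !mul0r add0r.
have [aj|aj] := eqVneq (a j) 0%N.
  rewrite aj !mul0r mulr0 raddf0 rmorph0.
  have -> : ((U_(j) + b)%MM == a) = false.
    by apply: contra_eqF aj => /eqP <-; rewrite mnmDE mnm1E eqxx.
  by rewrite !mul0r.
move: aA ba; rewrite (mnm_pick aj); set a' := (a - U_(j))%MM => aA ba.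
have a'A : mnm_on A a' by move: aA; rewrite mnm_onU jA.
have -> : (U_(j) + a' - U_(j))%MM = a' by apply/mnmP => i; rewrite mnmBE mnmDE addKn.
have -> : ((U_(j) + b)%MM == (U_(j) + a')%MM) = (b == a').
  by apply/eqP/eqP => [/mnmP e|->] //; apply/mnmP => i; have := e i; rewrite !mnmDE => /addnI.
rewrite mulrA IH //; last by rewrite !mdegD !mdeg1 in ba.
rewrite lead_cstU mnmDE mnm1E eqxx add1n !rmorphM rmorph_nat.
by rewrite -/(w j); ring.
Qed.

Hypothesis K0 : [pchar K] =i pred0.
Variables (w' : 'I_n -> Rg) (g : Rg).
Hypotheses (dg : forall i, i \in A -> mderiv i g = 0)
  (ww' : forall i, i \in A -> pi (mderiv i (P i) * w' i) = pi g).

(** Each [w' i] inverts the derivative of [P i] up to [pi g], and factorials are invertible in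
    characteristic 0. *)
Lemma lead_cst_inv m : mnm_on A m -> exists v, lead_cst m * pi v = pi g ^+ mdeg m.
Proof.
move=> mA; exists ((\prod_i ((m i)`!%:R : K)^-1)%:MP * \prod_i w' i ^+ m i).
rewrite mdegE expr_sum rmorphM rmorph_prod rmorph_prod rmorph_prod -!big_split /=.
apply: eq_bigr => i _; have [iA|iA] := boolP (i \in A); last first.
  by move/mnm_onP: mA => /(_ _ iA) ->; rewrite fact0 !expr0 invr1 !rmorph1 !mulr1.
rewrite -(ww' iA) rmorphM rmorphXn exprMn -/(w i).
have f0 : ((m i)`!%:R : K) != 0 by rewrite (pcharf0P K).1 // -lt0n fact_gt0.
have : pi ((m i)`!%:R)%:MP * pi (((m i)`!%:R)^-1)%:MP = 1.
  by rewrite -rmorphM -mpolyCM divff // !rmorph1.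
rewrite mpolyC_nat rmorph_nat => fE.
transitivity (((m i)`!%:R * pi (((m i)`!%:R : K)^-1)%:MP) * (w i ^+ m i * pi (w' i) ^+ m i)).
  by ring.
by rewrite fE mul1r.
Qed.

(** Induction on the order: monomials of degree [k] in the [P i] adjust the derivatives of order [k]
    and leave the lower ones alone. The power of [g] absorbs denominators and is a constant for
    derivatives along [A]. *)
Lemma jets_surjective k : exists l, forall c : 'X_{1..n} -> Rg, exists G,
  forall m, mnm_on A m -> (mdeg m < k)%N -> pi (mderivm m G) = pi g ^+ l * pi (c m).
Proof.
elim: k => [|k [l IH]]; first by exists 0%N => c; exists 0.
exists (k + l)%N => c; have [G GP] := IH c.
have /boolp.choice[v vP] : forall m, exists v, mnm_on A m -> lead_cst m * pi v = pi g ^+ mdeg m.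
  move=> m; have [mA|mA] := boolP (mnm_on A m); last by exists 0.
  by have [v vE] := lead_cst_inv mA; exists v.
(* The remaining discrepancy in the m-th derivative, divided by the leading constant up to a power
   of [g]. *)
pose C m := v m * (g ^+ l * c m - mderivm m G).
exists (g ^+ k * G + \sum_(a : 'X_{1..n < k.+1} | mnm_on A a && (mdeg a == k)) C a * mpow a).
move=> m mA mk.
have dgk i : i \in A -> mderiv i (g ^+ k) = 0.
  by move=> iA; rewrite mderivXn dg // mulr0.
rewrite mderivmD (mderivm_const _ dgk) // rmorphD rmorphM rmorphXn.
rewrite linear_sum rmorph_sum /=.
rewrite (eq_bigr (fun a : 'X_{1..n < k.+1} => (m == a)%:R * lead_cst a * pi (C a))); last first.
  by move=> a /andP[aA /eqP ak]; apply: mderivm_mpow; rewrite // ak.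
have [mk'|mk'] := ltnP (mdeg m) k.
  rewrite big1 => [|a /andP[aA /eqP ak]]; last first.
    have -> : (m == a) = false by apply: contraTF mk' => /eqP ->; rewrite ak ltnn.
    by rewrite !mul0r.
  by rewrite addr0 GP // exprD mulrA.
have dm : mdeg m = k by apply/eqP; rewrite eqn_leq -ltnS mk.
rewrite (bigD1 (BMultinom mk)) /=; last by rewrite mA dm eqxx.
rewrite eqxx mul1r big1 ?addr0 => [|a /andP[_ am]]; last first.
  have -> : (m == a) = false; last by rewrite !mul0r.
  by apply/negbTE; apply: contraNneq am => ma; apply/eqP/val_inj; rewrite /= -ma.
rewrite /C rmorphM mulrA vP // dm rmorphB rmorphM rmorphXn exprD.
by ring.
Qed.

End Derivations.

(** * Ideals and operators in K[t, x] *)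

Section Ideal.
Variables (K : fieldType) (n : nat).
Local Notation Rg := {mpoly K[n]}.
Implicit Types (I J : Rg -> Prop) (f g h : Rg).

Lemma ideal_sum I (J : Type) (r : seq J) (Q : pred J) (h : J -> Rg) :
  is_ideal I -> (forall j, Q j -> I (h j)) -> I (\sum_(j <- r | Q j) h j).
Proof. by case=> I0 ID _ Ih; elim/big_rec: _ => // j f Qj; apply: ID; apply: Ih. Qed.

Lemma idealB I f g : is_ideal I -> I f -> I g -> I (f - g).
Proof. by case=> I0 ID IM If Ig; apply: ID => //; rewrite -mulN1r; apply: IM. Qed.

Lemma ideal_mulr I f g : is_ideal I -> I f -> I (f * g).
Proof. by case=> I0 ID IM If; rewrite mulrC; apply: IM. Qed.

Lemma ideal_sub_radical I f : I f -> radical I f.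
Proof. by exists 1%N. Qed.

Lemma radical_prime I : primary_ideal I -> prime_ideal (radical I).
Proof.
case=> iI I1 Ip; have [I0 ID IM] := iI; split.
- split=> [|f g [k If] [l Ig]|f g [k Ig]]; first by exists 1%N.
  + exists (k + l)%N; rewrite exprDn; apply: ideal_sum => // i _.
    rewrite -mulr_natl; apply: (IM); have [ki|ki] := leqP k (k + l - i)%N.
      by apply: ideal_mulr => //; rewrite -(subnK ki) exprD; apply: IM.
    apply: (IM); have li : (l <= i)%N by lia.
    by rewrite -(subnK li) exprD; apply: IM.
  + by exists k; rewrite exprMn; apply: IM.
- by case=> k; rewrite expr1n.
move=> f g [k]; rewrite exprMn => /Ip[|[l]]; first by left; exists k.
by rewrite -exprM => ?; right; exists (k * l)%N.
Qed.

Lemma variety_radical I q f : in_variety I q -> radical I f -> f.@[q] = 0.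
Proof.
move=> Iq [k /Iq]; rewrite rmorphXn /= => /eqP.
by rewrite expf_eq0 => /andP[_ /eqP].
Qed.

(** Congruence to one's own value is stable under sums and products, so it suffices to test it on
    the variables. *)
Lemma ideal_ev_sub (ev : {rmorphism Rg -> K})
    (s : {rmorphism Rg -> Rg}) I :
    is_ideal I -> (forall c, ev c%:MP = c) -> (forall c, s c%:MP = c%:MP) ->
    (forall i, I (s 'X_i - (ev (s 'X_i))%:MP)) ->
  forall h, I (s h - (ev (s h))%:MP).
Proof.
move=> iI evC sC IX; elim/mpoly_ring_ind => // [c|f g If Ig|f g If Ig].
- by rewrite sC evC subrr; case: iI.
- have -> : s (f + g) - (ev (s (f + g)))%:MP =
    (s f - (ev (s f))%:MP) + (s g - (ev (s g))%:MP) by rewrite !rmorphD; ring.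
  by case: iI => _ ID _; apply: ID.
have -> : s (f * g) - (ev (s (f * g)))%:MP =
    s f * (s g - (ev (s g))%:MP) + (ev (s g))%:MP * (s f - (ev (s f))%:MP).
  by rewrite !rmorphM; ring.
by case: iI => _ ID IM; apply: ID; apply: IM.
Qed.

Lemma mderiv_restr (T : {set 'I_n}) i f : i \notin T -> mderiv i (restr T f) = 0.
Proof.
move=> iT; elim/mpoly_ring_ind: f => [c|j|f g IHf IHg|f g IHf IHg].
- by rewrite restrC mderivC.
- rewrite restrX; case: ifP => jT; last by rewrite raddf0.
  rewrite mderivX mnm1E; case: eqP => [ij|_]; last by rewrite scale0r.
  by rewrite -ij jT in iT.
- by rewrite rmorphD mderivD IHf IHg addr0.
- by rewrite rmorphM mderivM IHf IHg mul0r mulr0 addr0.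
Qed.

(** Each derivation lowers the exponent of [u] by at most one. *)
Lemma mderivm_dvd k m u f : exists h, mderivm m (u ^+ (k + mdeg m) * f) = u ^+ k * h.
Proof.
have mT : mnm_on [set: 'I_n] m by apply/mnm_onP => i; rewrite inE.
elim/mnm_on_ind: m / mT k f => [|j m _ _ IH] k f.
  by exists f; rewrite mderivm0m mdeg0 addn0.
rewrite mderivmU mdegD mdeg1 mderivM mderivXn addnS /=.
have -> : (k + mdeg m).+1%:R * u ^+ (k + mdeg m) * mderiv j u * f +
     u ^+ (k + mdeg m).+1 * mderiv j f = u ^+ (k + mdeg m) *
     ((k + mdeg m).+1%:R * mderiv j u * f + u * mderiv j f) by rewrite exprS; ring.
exact: IH.
Qed.

Lemma one_sub_exp_dvd u k : exists h : Rg, 1 - (1 - u) ^+ k = u * h.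
Proof.
elim: k => [|k [h hE]]; first by exists 0; rewrite expr0 subrr mulr0.
exists (h + (1 - u) ^+ k); rewrite exprS mulrDr -hE; ring.
Qed.

End Ideal.

(** Puts operators with different supports over one finite index set, as needed for linear and
    matrix arguments. *)
Lemma sum_msupp_bounded (K : nzRingType) n (V : nmodType) (p : {mpoly K[n]}) k
    (L : 'X_{1..n} -> K -> V) :
  (msize p <= k)%N -> (forall m, L m 0 = 0) ->
  \sum_(m <- msupp p) L m p@_m = \sum_(m : 'X_{1..n < k}) L m p@_m.
Proof.
move=> pk L0; pose I : subFinType _ := 'X_{1..n < k}.
rewrite (big_mksub I) ?msupp_uniq //=; last first.
  by move=> x /msize_mdeg_lt /leq_trans; apply.
by rewrite big_rmcond //= => i /memN_msupp_eq0 ->.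
Qed.

(** * Operators in the x variables, with the t variables as constants *)

Section TX.
Variables (K : fieldType) (d e : nat).
Local Notation Rg := {mpoly K[d + e]}.
Implicit Types (f g h : Rg) (I : Rg -> Prop).

Definition tset : {set 'I_(d + e)} := [set lshift e i | i : 'I_d].
Definition xset : {set 'I_(d + e)} := ~: tset.

Lemma lshift_tset i : lshift e i \in tset.
Proof. by apply/imsetP; exists i. Qed.

Lemma rshift_tset j : rshift d j \in tset = false.
Proof.
apply/negP => /imsetP[i _] /(congr1 val) /= E; have := ltn_ord i.
by rewrite -E ltnNge leq_addr.
Qed.

Lemma xsetP i : i \in xset -> exists j, i = rshift d j.
Proof.
rewrite inE; case: (split_ordP i) => [j ->|j ->]; last by exists j.
by rewrite lshift_tset.
Qed.

Lemma pt_l (t0 : 'I_d -> K) (x0 : 'I_e -> K) i : pt t0 x0 (lshift e i) = t0 i :> K.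
Proof. by rewrite /pt -[lshift e i]/(unsplit (inl i)) unsplitK. Qed.

Definition xpart (m : 'X_{1..d + e}) : 'X_{1..e} := [multinom m (rshift d j) | j < e].

Lemma xmon_l (m : 'X_{1..e}) i : xmon d m (lshift e i) = 0%N.
Proof. by rewrite mnmE -[lshift e i]/(unsplit (inl i)) unsplitK. Qed.

Lemma xmon_r (m : 'X_{1..e}) j : xmon d m (rshift d j) = m j.
Proof. by rewrite mnmE -[rshift d j]/(unsplit (inr j)) unsplitK. Qed.

Lemma xmonK (m : 'X_{1..e}) : xpart (xmon d m) = m.
Proof. by apply/mnmP => j; rewrite mnmE xmon_r. Qed.

Lemma xpartK m : mnm_on xset m -> xmon d (xpart m) = m.
Proof.
move/mnm_onP => mx; apply/mnmP => i; case: (split_ordP i) => j ->.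
  by rewrite xmon_l mx // inE lshift_tset.
by rewrite xmon_r mnmE.
Qed.

Lemma xmon_on (m : 'X_{1..e}) : mnm_on xset (xmon d m).
Proof.
apply/mnm_onP => i; rewrite inE negbK => /imsetP[j _ ->]; exact: xmon_l.
Qed.

Lemma mdeg_xmon (m : 'X_{1..e}) : mdeg (xmon d m) = mdeg m.
Proof.
rewrite !mdegE big_split_ord /= big1 => [|i _]; last exact: xmon_l.
by apply: eq_bigr => j _; rewrite xmon_r.
Qed.

Lemma capplyE (D : Rg) f k : (msize D <= k)%N ->
  capply D f = \sum_(m : 'X_{1.. (d + e)%N < k}) D@_m *: mderivm m f.
Proof.
by move=> Dk; apply: (sum_msupp_bounded (L := fun m c => c *: mderivm m f)) => // m; rewrite scale0r.
Qed.

Lemma capply_is_linear f : linear (fun D : Rg => capply D f).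
Proof.
move=> c D D'; pose k := maxn (msize (c *: D + D')) (maxn (msize D) (msize D')).
rewrite !(@capplyE _ _ k) ?leq_max ?leqnn ?orbT // scaler_sumr -big_split /=.
by apply: eq_bigr => m _; rewrite mcoeffD mcoeffZ scalerDl scalerA.
Qed.

Lemma capplyX m f : capply 'X_[m] f = mderivm m f.
Proof. by rewrite /capply msuppX big_seq1 mcoeffX eqxx scale1r. Qed.

Lemma capply_sum (J : Type) (r : seq J) (c : J -> K) (D : J -> Rg) f :
  capply (\sum_(j <- r) c j *: D j) f = \sum_(j <- r) c j *: capply (D j) f.
Proof.
elim: r => [|j r IH]; first by rewrite !big_nil /capply msupp0 big_nil.
by rewrite !big_cons capply_is_linear IH.
Qed.

Lemma embxE (E : {mpoly K[e]}) : embx d E = \sum_(m <- msupp E) E@_m *: 'X_[xmon d m].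
Proof.
rewrite /embx comp_mpolyE; apply: eq_bigr => m _; congr (_ *: _).
rewrite [RHS]mpolyXE_id big_split_ord /= [X in _ = X * _]big1 => [|i _]; last by rewrite xmon_l expr0.
by rewrite mul1r; apply: eq_bigr => j _; rewrite tnth_mktuple xmon_r.
Qed.

Lemma embx_sum (J : Type) (r : seq J) (c : J -> K) (D : J -> {mpoly K[e]}) :
  embx d (\sum_(j <- r) c j *: D j) = \sum_(j <- r) c j *: embx d (D j).
Proof. by rewrite /embx raddf_sum; apply: eq_bigr => j _; exact: comp_mpolyZ. Qed.

Lemma capply_embx (E : {mpoly K[e]}) f :
  capply (embx d E) f = \sum_(m <- msupp E) E@_m *: mderivm (xmon d m) f.
Proof. by rewrite embxE capply_sum; apply: eq_bigr => m _; rewrite capplyX. Qed.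

Lemma specialize_apply (N : xop K d e) q f :
  (capply (embx d (specialize N q)) f).@[q] = (xapply N f).@[q].
Proof.
rewrite /specialize embx_sum capply_sum !rmorph_sum /=; apply: eq_bigr => m _.
rewrite mevalZ rmorphM; congr (_ * _).
by rewrite capply_embx msuppX big_seq1 mcoeffX eqxx scale1r.
Qed.

Lemma mcoeff_specialize (N : xop K d e) q m : (specialize N q)@_m = (N@_m).@[q].
Proof.
rewrite /specialize raddf_sum /= [in RHS](mpolyE N) raddf_sum rmorph_sum /=.
apply: eq_bigr => a _; rewrite !mcoeffZ !mcoeffX rmorphM /=.
by case: (a == m); rewrite ?rmorph1 ?rmorph0.
Qed.

Lemma xapplyE (N : xop K d e) f k : (msize N <= k)%N ->
  xapply N f = \sum_(m : 'X_{1..e < k}) N@_m * mderivm (xmon d m) f.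
Proof.
move=> Nk; apply: (sum_msupp_bounded (L := fun m c => c * mderivm (xmon d m) f)) => // m.
by rewrite mul0r.
Qed.

Lemma xapplyD (N : xop K d e) f g : xapply N (f + g) = xapply N f + xapply N g.
Proof. by rewrite -big_split /=; apply: eq_bigr => m _; rewrite mderivmD mulrDr. Qed.

Lemma xapply_sum (N : xop K d e) (J : finType) (h : J -> Rg) :
  xapply N (\sum_j h j) = \sum_j xapply N (h j).
Proof.
elim/big_rec2: _ => [|j f g _ <-]; last by rewrite xapplyD.
by apply: big1 => m _; rewrite raddf0 mulr0.
Qed.

Lemma mderivm_xmon_tconst g f m : restr tset g = g ->
  mderivm (xmon d m) (g * f) = g * mderivm (xmon d m) f.
Proof.
move=> gT; apply: (@mderivm_const _ _ xset); last exact: xmon_on.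
by move=> i; rewrite inE => iT; rewrite -gT mderiv_restr.
Qed.

(** Operators involving only x-derivatives are linear over the polynomials in t. *)
Lemma xapply_tconst (N : xop K d e) g f : restr tset g = g ->
  xapply N (g * f) = g * xapply N f.
Proof.
move=> gT; rewrite /xapply mulr_sumr; apply: eq_bigr => m _.
by rewrite mderivm_xmon_tconst // mulrCA.
Qed.

Lemma restr_tvarB (t0 : 'I_d -> K) i :
  restr tset (tvar K e i - (t0 i)%:MP) = tvar K e i - (t0 i)%:MP.
Proof. by rewrite rmorphB /= restrX lshift_tset restrC. Qed.

Lemma add_t_is_ideal I (t0 : 'I_d -> K) : is_ideal I -> is_ideal (add_t_ideal I t0).
Proof.
move=> [I0 ID IM]; split=> [|f g [a [b [Ia ->]]] [a' [b' [Ia' ->]]]|f g [a [b [Ia ->]]]].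
- by exists 0, (fun=> 0); split=> //; rewrite big1 ?addr0 // => i _; rewrite mul0r.
- exists (a + a'), (fun i => b i + b' i); split; first exact: ID.
  rewrite addrACA; congr (_ + _); rewrite -big_split; apply: eq_bigr => i _ /=.
  by rewrite mulrDl.
- exists (f * a), (fun i => f * b i); split; first exact: IM.
  by rewrite mulrDr mulr_sumr; congr (_ + _); apply: eq_bigr => i _; rewrite mulrA.
Qed.

Lemma add_t_ideal_l I (t0 : 'I_d -> K) f : I f -> add_t_ideal I t0 f.
Proof.
by move=> If; exists f, (fun=> 0); split=> //; rewrite big1 ?addr0 // => i _; rewrite mul0r.
Qed.

Lemma add_t_ideal_r I (t0 : 'I_d -> K) f i : is_ideal I ->
  add_t_ideal I t0 (f * (tvar K e i - (t0 i)%:MP)).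
Proof.
move=> [I0 _ _]; exists 0, (fun j => if j == i then f else 0); split=> //.
rewrite add0r (bigD1 i) //= eqxx big1 ?addr0 // => j /negPf ->.
by rewrite mul0r.
Qed.

(** Sending the x variables to 0 turns an element of R involving only t into a polynomial on K^d,
    the form required of the genericity condition. *)
Definition to_t : Rg -> {mpoly K[d]} :=
  mmap (@mpolyC d K) (fun i => match split i with inl j => 'X_j | inr _ => 0 end).
HB.instance Definition _ := GRing.RMorphism.on to_t.

Lemma to_tK f : to_t f \mPo [tuple tvar K e i | i < d] = restr tset f.
Proof.
elim/mpoly_ring_ind: f => [c|i|f g IHf IHg|f g IHf IHg].
- by rewrite /to_t mmapC comp_mpolyC restrC.
- rewrite /to_t mmapX mmap1U restrX; case: (split_ordP i) => j -> /=.
    by rewrite lshift_tset comp_mpolyXU -tnth_nth tnth_mktuple.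
  by rewrite rshift_tset comp_mpoly0.
- by rewrite [RHS]rmorphD /= -IHf -IHg [to_t _]rmorphD; exact: comp_mpolyD.
- by rewrite [RHS]rmorphM /= -IHf -IHg [to_t _]rmorphM; exact: rmorphM.
Qed.

Lemma to_t_eval f (t0 : 'I_d -> K) (x0 : 'I_e -> K) : (to_t f).@[t0] = (restr tset f).@[pt t0 x0].
Proof.
rewrite -to_tK comp_mpoly_meval; apply: meval_eq => i.
by rewrite tnth_mktuple mevalXU pt_l.
Qed.

Lemma t_independent_radical I : t_independent I -> indep_mod (radical I) tset.
Proof.
move=> It f fT [k If].
have fk : restr tset (f ^+ k) = f ^+ k by rewrite rmorphXn /= fT.
have t0 : to_t (f ^+ k) = 0 by apply: It; rewrite to_tK fk.
have /eqP : f ^+ k = 0 by rewrite -fk -to_tK t0 raddf0.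
by rewrite expf_eq0 => /andP[_ /eqP].
Qed.

Hypothesis K0 : [pchar K] =i pred0.

(** Here the dimension enters: an independent set of d + 1 variables modulo the radical would give a
    chain of d + 1 strict inclusions of primes above [I]. *)
Lemma dim_max_indep I (F : fieldType) (pi : {rmorphism Rg -> F}) :
    primary_ideal I -> krull_dim_eq I d -> t_independent I ->
    (forall f, pi f = 0 <-> radical I f) ->
  max_indep pi tset.
Proof.
move=> Ip [_ Id] It piP; split.
  by move=> f fT /piP; apply: t_independent_radical.
move=> j jT ij; apply: Id.
have [c [[cp c0 cs cn] cE]] : exists c, prime_chain_over (radical I) #|j |: tset| c /\ c 0%N = radical I.
  apply: prime_chain_from => //; first exact: radical_prime.
  by move=> f fT /piP; apply: ij.
have cT : #|j |: tset| = d.+1.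
  by rewrite cardsU1 jT card_imset ?card_ord //; apply: lshift_inj.
rewrite cT in cp c0 cs cn; exists c; split=> // f If; apply: c0.
exact: ideal_sub_radical.
Qed.

End TX.

(** * The generic fibre *)

Lemma mderiv_horner (K : fieldType) n (i j : 'I_n) (p : {poly {mpoly K[n]}}) :
  (forall k, mderiv i p`_k = 0) ->
  mderiv i p.['X_j] = (j == i)%:R * p^`().['X_j].
Proof.
elim/poly_ind: p => [_|p c IH pc].
  by rewrite horner0 raddf0 deriv0 horner0 mulr0.
have p0 k : mderiv i p`_k = 0.
  by have := pc k.+1; rewrite coefD coefMX coefC addr0.
have c0 : mderiv i c = 0 by have := pc 0%N; rewrite coefD coefMX coefC add0r.
rewrite hornerD hornerMX hornerC mderivD mderivM c0 addr0 IH //.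
rewrite derivD derivC addr0 derivM derivX mulr1 hornerD hornerMX.
rewrite mderivX mnm1E; case: eqP => [->|_]; last by rewrite !mul0r scale0r mulr0 addr0.
have -> : (U_(i) - U_(i) = 0)%MM by apply/mnmP => k; rewrite mnmBE subnn mnm0E.
by rewrite mpolyX0 scale1r mulr1 !mul1r addrC.
Qed.

Section GenericFibre.
Variables (K : fieldType) (n : nat).
Hypothesis K0 : [pchar K] =i pred0.
Local Notation Rg := {mpoly K[n]}.
Variables (F : fieldType) (pi : {rmorphism Rg -> F}) (T : {set 'I_n}).
Hypothesis mT : max_indep pi T.
Hypothesis pi_frac : forall z, exists a b, pi b != 0 /\ z = pi a / pi b.

(** As long as the derivative of a relation also vanishes at [X_j], it replaces the relation. In
    characteristic 0 it stays nonzero while the degree drops, so the process stops. *)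
Lemma separable_relation j : j \notin T -> exists p : {poly Rg},
  [/\ map_poly (restr T) p = p, pi p.['X_j] = 0 & pi p^`().['X_j] != 0].
Proof.
have [iT maxT] := mT => jT.
have [p [p0 pT pj]] := dep_relation jT (maxT _ jT).
have {pj} : pi p.['X_j] = 0 by rewrite -horner_map.
move: {2}(size p) (leqnn (size p)) => s; elim: s p p0 pT => [|s IH] p p0 pT ps pj.
  by move: ps; rewrite leqn0 size_poly_eq0 (negPf p0).
have [dp0|] := eqVneq (pi p^`().['X_j]) 0; last by exists p.
have co k : restr T p`_k = p`_k by rewrite -{2}pT coef_map.
(* A relation of degree 0 is excluded by the independence of [T]. *)
have [sp|sp] := leqP (size p) 1%N.
  have pE := size1_polyC sp; move: pj p0; rewrite pE hornerC polyC_eq0 => pc /eqP[].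
  exact: iT.
apply: (IH p^`()) => //; last by rewrite -ltnS (leq_trans _ ps) // lt_size_deriv.
  have : lead_coef p != 0 by rewrite lead_coef_eq0.
  apply: contraNneq => dp; rewrite lead_coefE.
  have := congr1 (fun q : {poly Rg} => q`_(size p).-2) dp.
  rewrite coef_deriv coef0 -mulr_natr -(mpolyC_nat n) => /eqP.
  rewrite mulf_eq0 mpolyC_eq0 (pcharf0P K).1 // orbF.
  by move: sp; case: (size p) => [|[]].
by rewrite -deriv_map pT.
Qed.

Lemma common_denominator (J : finType) (z : J -> F) : exists g,
  [/\ restr T g = g, g != 0 & forall j, exists a, pi g * z j = pi a].
Proof.
have /boolp.choice[g gP] : forall j, exists g, [/\ restr T g = g, g != 0 & exists a, pi g * z j = pi a].
  move=> j; have [a [b [b0 ->]]] := pi_frac (z j).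
  have [g [h [gT g0 hE]]] := max_indep_denominator mT b0.
  exists g; split=> //; exists (a * h).
  by rewrite -hE !rmorphM; field.
exists (\prod_j g j); split.
- by rewrite rmorph_prod; apply: eq_bigr => j _; case: (gP j).
- by apply/prodf_neq0 => j _; case: (gP j).
move=> j; case: (gP j) => _ _ [a aE]; exists (a * \prod_(i | i != j) g i).
by rewrite (bigD1 j) //= !rmorphM -aE; ring.
Qed.

End GenericFibre.

(** * Surjectivity of a maximal independent family of Noetherian operators *)

Section NoetherianOperators.
Variables (K : fieldType) (d e : nat).
Hypothesis K0 : [pchar K] =i pred0.
Local Notation Rg := {mpoly K[d + e]}.
Local Notation T := (tset d e).
Variables (F : fieldType) (pi : {rmorphism Rg -> F}).
Hypothesis mT : max_indep pi T.
Hypothesis pi_frac : forall z, exists a b, pi b != 0 /\ z = pi a / pi b.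

(** One [g] in t alone serves for all x variables: modulo the kernel of [pi], each derivative of
    [p j] at its variable divides [g], so it cannot vanish at a point of the variety where [g] does
    not. *)
Lemma separators : exists (p : 'I_e -> {poly Rg}) (v : 'I_e -> Rg) g,
  [/\ restr T g = g, g != 0 & forall j,
     [/\ map_poly (restr T) (p j) = p j, pi (p j).['X_(rshift d j)] = 0 &
         pi ((p j)^`().['X_(rshift d j)] * v j) = pi g]].
Proof.
have rT j : rshift d j \notin T by rewrite rshift_tset.
have /boolp.choice[p pP] := fun j => separable_relation K0 mT (rT j).
have /boolp.choice[v vP] : forall j, exists v, restr T v.1 = v.1 /\ v.1 != 0 /\
    pi ((p j)^`().['X_(rshift d j)] * v.2) = pi v.1.
  move=> j; case: (pP j) => _ _ /(max_indep_denominator mT)[g [h [gT g0 hE]]].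
  by exists (g, h).
exists p, (fun j => (v j).2 * \prod_(i | i != j) (v i).1), (\prod_i (v i).1); split.
- by rewrite rmorph_prod; apply: eq_bigr => j _; case: (vP j).
- by apply/prodf_neq0 => j _; case: (vP j) => _ [].
move=> j; case: (pP j) (vP j) => pT p0 _ [_ [_ vE]]; split=> //.
by rewrite mulrA rmorphM vE -rmorphM [in RHS](bigD1 j).
Qed.

(** The coefficients of the [N i] modulo the radical form a matrix acting on x-jets. A maximal set
    of independent rows still detects [I] and has a right inverse; jets through that inverse realise
    every vector, up to denominators in t. *)
Lemma noetherian_surjective (I : Rg -> Prop) m (N : 'I_m -> xop K d e) :
    noetherian_family I (fun _ => True) N -> (forall f, pi f = 0 <-> radical I f) ->
  exists r (s : 'I_r -> 'I_m) h, [/\ restr T h = h, h != 0,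
    (forall f, (forall i, pi (xapply (N (s i)) f) = 0) -> I f) &
    (forall b : 'I_r -> Rg, exists B, forall i, pi (xapply (N (s i)) B) = pi (h * b i))].
Proof.
move=> NI piP; have [p [v [g [gT g0 pv]]]] := separators.
pose k := \max_i msize (N i); have Nk i : (msize (N i) <= k)%N by apply: leq_bigmax.
pose X : finType := 'X_{1..e < k}.
pose xm (a : 'I_#|X|) : 'X_{1..e} := bmnm (enum_val a).
pose M : 'M[F]_(m, #|X|) := \matrix_(i, a) pi (N i)@_(xm a).
pose jet f : 'cV[F]_#|X| := \col_a pi (mderivm (xmon d (xm a)) f).
have MjetE i f : (M *m jet f) i 0 = pi (xapply (N i) f).
  rewrite (xapplyE f (Nk i)) rmorph_sum mxE (big_enum_val (A := X)) /=.
  by apply: eq_bigr => a _; rewrite !mxE rmorphM.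
pose s := maxrankfun M; pose M' := rowsub s M; pose V := pinvmx M'.
have M'V : M' *m V = 1%:M by apply: mulmxVp; apply: maxrowsub_free.
(* [h] clears the denominators of the right inverse; [L] lifts the entries of [h] times that inverse
   to R. *)
have [h [hT h0 hL]] := common_denominator mT pi_frac (fun u : 'I_#|X| * 'I_(\rank M) => V u.1 u.2).
have /boolp.choice[L LE] := hL.
(* Local coordinates p_j(t, x_j); the value 0 at the t indices is a filler outside [xset]. *)
pose PP (i : 'I_(d + e)) : Rg := match split i with inl _ => 0 | inr j => (p j).['X_(rshift d j)] end.
pose vv (i : 'I_(d + e)) : Rg := match split i with inl _ => 0 | inr j => v j end.
have PPr j : PP (rshift d j) = (p j).['X_(rshift d j)].
  by rewrite /PP (unsplitK (inr j)).
have vvr j : vv (rshift d j) = v j by rewrite /vv (unsplitK (inr j)).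
have dPP j i : i \in xset d e ->
    mderiv i (PP (rshift d j)) = (rshift d j == i)%:R * (p j)^`().['X_(rshift d j)].
  move=> ix; rewrite PPr mderiv_horner // => l.
  have -> : (p j)`_l = restr T (p j)`_l by case: (pv j) => pT _ _; rewrite -{1}pT coef_map.
  by rewrite mderiv_restr //; rewrite inE in ix.
have [||||l lP] := @jets_surjective K (d + e) F pi (xset d e) PP _ _ K0 vv g _ _ k.
- by move=> i /xsetP[j ->]; rewrite PPr; case: (pv j).
- by move=> i j /xsetP[i' ->] jx ij; rewrite dPP // (negPf ij) mul0r.
- by move=> i; rewrite inE => iT; rewrite -gT mderiv_restr.
- move=> i ix; have [j ij] := xsetP ix; rewrite ij dPP -?ij // ij eqxx mul1r vvr.
  by case: (pv j).
exists (\rank M), s, (g ^+ l * h); split.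
- by rewrite rmorphM rmorphXn /= gT hT.
- by rewrite mulf_neq0 // expf_neq0.
- move=> f f0; apply/NI => i _; apply/piP; rewrite -MjetE.
  (* All rows of [M] are combinations of the selected ones, so the omitted operators also send [f]
     into the radical. *)
  have /submxP[Y ->] : (M <= M')%MS by rewrite eq_maxrowsub.
  have -> : Y *m M' *m jet f = 0; last by rewrite mxE.
  rewrite -mulmxA (_ : M' *m jet f = 0) ?mulmx0 //.
  apply/matrixP => a b; rewrite mul_rowsub_mx !mxE (ord1 b) -[RHS](f0 a) -MjetE.
  by rewrite mxE.
(* The jet to prescribe is [h] times the right inverse applied to [b]. The outer condition on [a]
   selects the index of [u], and gives 0 when [u] is out of range. *)
move=> b; pose c (u : 'X_{1..d + e}) : Rg :=
  \sum_a \sum_(i | xm a == xpart u) L (a, i) * b i.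
have [B BP] := lP c; exists B => i.
pose bb : 'cV[F]_(\rank M) := \col_i pi (b i).
have jB : jet B = (pi g ^+ l * pi h) *: (V *m bb).
  apply/matrixP => a z; rewrite !mxE BP ?xmon_on //; last by rewrite mdeg_xmon bmdeg.
  rewrite -mulrA; congr (_ * _); rewrite /c xmonK rmorph_sum (bigD1 a) //=.
  rewrite [X in _ + X]big1 ?addr0 => [|a' a'a]; last first.
    rewrite big1 ?rmorph0 // => i'; rewrite /xm => /eqP/val_inj/enum_val_inj aa.
    by rewrite aa eqxx in a'a.
  rewrite eqxx rmorph_sum mulr_sumr; apply: eq_bigr => i' _.
  by rewrite rmorphM -LE !mxE /= mulrA.
have -> : pi (xapply (N (s i)) B) = (M' *m jet B) i 0.
  by rewrite mul_rowsub_mx !mxE -MjetE mxE.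
rewrite jB -scalemxAr mulmxA M'V mul1mx !mxE.
by rewrite !rmorphM rmorphXn.
Qed.

End NoetherianOperators.

(** * The fibre through a point *)

Section Point.
Variables (K : fieldType) (d e : nat).
Hypothesis K0 : [pchar K] =i pred0.
Local Notation Rg := {mpoly K[d + e]}.
Variables (t0 : 'I_d -> K) (x0 : 'I_e -> K).
Local Notation q := (pt t0 x0).
Implicit Types (I : Rg -> Prop) (f g h D : Rg).

Lemma meval_tvarB i : (tvar K e i - (t0 i)%:MP).@[q] = 0.
Proof. by rewrite mevalB mevalXU mevalC pt_l subrr. Qed.

(** At q, a specialized operator acts as [N i] does: it sends [I] into the radical, which vanishes
    at q, and lets each factor [t_j - t0_j] pass through and vanish. *)
Lemma specialize_Dmq I m (N : 'I_m -> xop K d e) (c : 'I_m -> K) :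
    (forall f i, I f -> radical I (xapply (N i) f)) -> in_variety I q ->
  Dmq q (add_t_ideal I t0) (\sum_i c i *: embx d (specialize (N i) q)).
Proof.
move=> NI Iq f [a [b [Ia ->]]]; rewrite capply_sum rmorph_sum big1 // => i _ /=.
rewrite mevalZ specialize_apply xapplyD mevalD.
rewrite (variety_radical Iq) ?add0r; last exact: NI.
rewrite xapply_sum rmorph_sum big1 ?mulr0 // => j _.
by rewrite /= mulrC xapply_tconst ?restr_tvarB // mevalM meval_tvarB mul0r.
Qed.

Let qvar i : Rg := 'X_i - (q i)%:MP.

Let meval_qvar i : (qvar i).@[q] = 0.
Proof. by rewrite mevalB mevalXU mevalC subrr. Qed.

Let mderiv_qvar i j : mderiv j (qvar i) = (i == j)%:R.
Proof.
rewrite mderivB mderivC subr0 mderivX mnm1E; case: eqP => [->|_]; last by rewrite scale0r.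
have -> : (U_(j) - U_(j) = 0)%MM by apply/mnmP => k; rewrite mnmBE subnn mnm0E.
by rewrite mpolyX0 scale1r.
Qed.

(** The jet construction with evaluation at q as [pi], the differences [X_i - q_i] as local
    coordinates, and denominator 1. *)
Lemma jets_at_point k (c : 'X_{1..e} -> K) : exists f,
  forall m, (mdeg m < k)%N -> (mderivm (xmon d m) f).@[q] = c m.
Proof.
have [||||l lP] := @jets_surjective K (d + e) K (meval q) (xset d e) qvar _ _ K0
    (fun=> 1) 1 _ _ k.
- by move=> i _; exact: meval_qvar.
- by move=> i j _ _ /negPf ij; rewrite mderiv_qvar ij.
- by move=> i _; rewrite mderiv1.
- by move=> i _; rewrite mderiv_qvar eqxx mulr1.
have [f fP] := lP (fun m => (c (xpart m))%:MP); exists f => m mk.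
rewrite -[LHS]/(meval q _) fP ?xmon_on ?mdeg_xmon // rmorph1 expr1n mul1r xmonK; exact: mevalC.
Qed.

(** Downward induction on the order of [m]. The test function (X - q)^m has a factor [t_j - t0_j],
    so [D] kills it at q. Among orders up to that of [m] only the m-th derivative is nonzero at q;
    higher terms with a t-derivative vanish by induction, and pure x-derivatives keep the factor. *)
Lemma Dmq_support I D m : is_ideal I -> Dmq q (add_t_ideal I t0) D ->
  ~~ mnm_on (xset d e) m -> D@_m = 0.
Proof.
move=> iI Dq; move: {2}(msize D - mdeg m)%N (leqnn (msize D - mdeg m)) => s.
elim: s m => [|s IH] m ms mx.
  by apply/memN_msupp_eq0/msize_mdeg_ge; rewrite -subn_eq0 -leqn0.
have /forallPn[i] := mx; rewrite negb_or inE negbK => /andP[/imsetP[j _ ij] mi].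
pose h := mpow qvar (m - U_(i))%MM.
have fE : mpow qvar m = (tvar K e j - (t0 j)%:MP) * h.
  rewrite /h /mpow (bigD1 i) //= [in RHS](bigD1 i) //= mnmBE mnm1E eqxx.
  rewrite [in RHS](eq_bigr (fun i => qvar i ^+ m i)); last first.
    by move=> l li; rewrite mnmBE mnm1E eq_sym (negPf li) subn0.
  rewrite mulrA; congr (_ * _); rewrite /qvar ij pt_l -exprS.
  by rewrite subn1 prednK // lt0n -ij.
have : (capply D (mpow qvar m)).@[q] = 0.
  by apply: Dq; rewrite fE mulrC; apply: add_t_ideal_r.
have on m' : mnm_on [set: 'I_(d + e)] m' by apply/mnm_onP => l; rewrite inE.
have delta m' : (mdeg m' <= mdeg m)%N ->
    (mderivm m' (mpow qvar m)).@[q] = (m' == m)%:R * lead_cst (meval q) qvar m.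
  move=> mm; rewrite -[mpow qvar m]mul1r.
  rewrite (@mderivm_mpow _ _ _ _ [set: 'I_(d + e)]) ?rmorph1 ?mulr1 //.
    by move=> l _; apply: meval_qvar.
  by move=> l l' _ _ /negPf ll; rewrite mderiv_qvar ll.
have lc0 : lead_cst (meval q) qvar m != 0.
  apply/prodf_neq0 => l _; rewrite mderiv_qvar eqxx rmorph1 expr1n mulr1.
  by rewrite (pcharf0P K).1 // -lt0n fact_gt0.
have [mD|/memN_msupp_eq0 //] := boolP (m \in msupp D).
rewrite /capply (bigD1_seq m) //= mevalD mevalZ delta // eqxx mul1r.
rewrite rmorph_sum big1_seq ?addr0 => [/eqP|m' /andP[m'm m'D]].
  by rewrite mulf_eq0 (negPf lc0) orbF => /eqP.
rewrite /= mevalZ; have [mm|mm] := leqP (mdeg m') (mdeg m).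
  by rewrite delta // (negPf m'm) mul0r mulr0.
have [m'x|m'x] := boolP (mnm_on (xset d e) m'); last first.
  rewrite IH ?mul0r //; rewrite -ltnS; apply: leq_trans ms.
  by rewrite ltn_sub2l // (leq_trans _ (msize_mdeg_lt m'D)) // ltnS ltnW.
by rewrite fE -(xpartK m'x) mderivm_xmon_tconst ?restr_tvarB // mevalM meval_tvarB mul0r mulr0.
Qed.

Lemma embx_of_support D : (forall m, ~~ mnm_on (xset d e) m -> D@_m = 0) ->
  exists E, D = embx d E.
Proof.
move=> Dx; exists (\sum_(m <- msupp D) D@_m *: 'X_[xpart m]).
rewrite embx_sum {1}(mpolyE D); apply: eq_big_seq => m mD; congr (_ *: _).
rewrite embxE msuppX big_seq1 mcoeffX eqxx scale1r xpartK //.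
by apply: contraTT mD => /Dx; rewrite mcoeff_msupp negbK => ->.
Qed.

(* p(t0, x_j) = (x_j - x0_j) u(x_j) with u(x0_j) <> 0: the fibre of P over t0 is
   reduced at q, so a multiple of the u's turns the maximal ideal of q into P + (t - t0). *)
Lemma reduced_fibre P (p : 'I_e -> {poly Rg}) :
    is_ideal P -> in_variety P q ->
    (forall j, map_poly (restr (tset d e)) (p j) = p j) ->
    (forall j, P (p j).['X_(rshift d j)]) ->
    (forall j, (p j)^`().['X_(rshift d j)].@[q] != 0) ->
  exists u, u.@[q] = 1 /\ forall h, h.@[q] = 0 -> add_t_ideal P t0 (u * h).
Proof.
move=> iP Pq pT pP p'q; pose a := add_t_ideal P t0.
have ia : is_ideal a by apply: add_t_is_ideal.
have [a0 aD aM] := ia.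
have a_t i : a ('X_(lshift e i) - (t0 i)%:MP).
  by rewrite -[_ - _]mul1r; apply: add_t_ideal_r.
(* Modulo [t - t0], a polynomial in t equals its value at [t0]. *)
have a_restr h : a (restr (tset d e) h - (restr (tset d e) h).@[q]%:MP).
  apply: (@ideal_ev_sub _ _ (meval q) (restr (tset d e))) => // [c|c|i].
  - by rewrite /= mevalC.
  - by rewrite /= restrC.
  rewrite /= restrX; case: (split_ordP i) => j ->.
    by rewrite lshift_tset mevalXU pt_l.
  by rewrite rshift_tset raddf0 mpolyC0 subrr.
have /boolp.choice[w wP] : forall j, exists w,
    w.@[q] != 0 /\ a (w * ('X_(rshift d j) - (x0 j)%:MP)).
  move=> j; set y := 'X_(rshift d j) : Rg; set x := x0 j.
  have yq : y.@[q] = x by rewrite mevalXU /pt (unsplitK (inr j)).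
  pose pq := map_poly (meval q) (p j).
  have /factor_theorem[v vE] : root pq x.
    by rewrite rootE /pq -yq horner_map /= Pq.
  pose inj := map_poly (@mpolyC (d + e) K).
  have injq r : (inj r).[y].@[q] = r.[x].
    rewrite -yq -horner_map /= /inj -map_poly_comp; congr (_.[_]).
    by rewrite (eq_map_poly (g := id)) ?map_poly_id // => c /=; rewrite mevalC.
  exists (inj v).[y]; split.
    rewrite injq; apply: contraNneq (p'q j) => v0.
    rewrite -horner_map /= -deriv_map -/pq vE yq derivM derivXsubC mulr1.
    by rewrite hornerD hornerM hornerXsubC subrr mulr0 add0r v0.
  have -> : (inj v).[y] * (y - x%:MP) = (inj pq).[y].
    rewrite vE /inj rmorphM /= hornerM; congr (_ * _).
    by rewrite rmorphB /= map_polyX map_polyC /= hornerXsubC.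
  (* Specializing the coefficients of [p j], which involve only t, changes it by an element of the
     ideal of [t - t0]. *)
  have -> : (inj pq).[y] = (p j).[y] - (p j - inj pq).[y].
    by rewrite hornerD hornerN; ring.
  apply: idealB => //; first by apply: add_t_ideal_l; apply: pP.
  rewrite horner_coef; apply: ideal_sum => // k _; apply: ideal_mulr => //.
  rewrite coefB /inj coef_map /pq coef_map /=.
  by have := a_restr (p j)`_k; rewrite -coef_map pT.
pose W := \prod_j w j.
have Wq : W.@[q] != 0.
  by rewrite rmorph_prod; apply/prodf_neq0 => j _; case: (wP j).
(* [W] multiplies every [X_i - q_i] into [a]: the t ones already lie there, and each x one is
   handled by its own factor [w j]. *)
have aW h : a (W * (h - h.@[q]%:MP)).
  apply: (@ideal_ev_sub _ _ (meval q) idfun (fun h => a (W * h))) => // [|c|i].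
  - split=> [|f g af ag|f g ag]; first by rewrite mulr0.
      by rewrite mulrDr; apply: aD.
    by rewrite mulrCA; apply: aM.
  - by rewrite /= mevalC.
  rewrite /= mevalXU; case: (split_ordP i) => j ->.
    by apply: aM; rewrite pt_l; apply: a_t.
  rewrite /W (bigD1 j) //= mulrAC [_ * \prod_(_ | _) _]mulrC; apply: aM.
  by rewrite /pt (unsplitK (inr j)); case: (wP j).
exists ((W.@[q]^-1)%:MP * W); split.
  by rewrite mevalM mevalC mulVf.
move=> h h0; rewrite -mulrA; apply: (aM).
by have := aW h; rewrite h0 mpolyC0 subr0.
Qed.

End Point.

(** * Specialization *)

Section Cutoff.
Variables (K : fieldType) (d e : nat) (q : 'I_(d + e) -> K).
Local Notation Rg := {mpoly K[d + e]}.

(* With y = u^a, the multiplier 1 - (1 - y)^b is divisible by u^a and congruent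
   to 1 modulo the b-th power of the maximal ideal of q. *)
Lemma cutoff (u f : Rg) a b : u.@[q] = 1 -> exists f',
  (forall m, (mdeg m < a)%N -> exists h, mderivm m f' = u * h) /\
  (forall m, (mdeg m < b)%N -> (mderivm m f').@[q] = (mderivm m f).@[q]).
Proof.
move=> uq; have [h hE] := one_sub_exp_dvd (u ^+ a) b.
exists ((1 - (1 - u ^+ a) ^+ b) * f); split=> m mk.
  have [h' h'E] := mderivm_dvd (a - mdeg m) m u (h * f).
  rewrite hE -mulrA -{1}(subnK (ltnW mk)) h'E.
  exists (u ^+ (a - mdeg m).-1 * h').
  by rewrite mulrA -exprS prednK // subn_gt0.
have [h' h'E] := mderivm_dvd (b - mdeg m) m (1 - u ^+ a) f.
rewrite subnK in h'E; last exact: ltnW.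
rewrite mulrBl mul1r mderivmB h'E mevalB mevalM rmorphXn rmorphB rmorph1 rmorphXn /= uq.
by rewrite expr1n subrr expr0n subn_eq0 leqNgt mk mul0r subr0.
Qed.

End Cutoff.

(** By duality, if [E] is outside the span, some jet at q is killed by all specialized operators but
    not by [E]. A function with this jet, corrected by an element of the ideal of [t - t0], lands in
    [I] and contradicts the hypothesis on [E]. *)
Lemma specialization_span (K : fieldType) (d e : nat) (I : {mpoly K[d + e]} -> Prop)
    r m (s : 'I_r -> 'I_m) (N : 'I_m -> xop K d e) (h : {mpoly K[d + e]})
    (t0 : 'I_d -> K) (x0 : 'I_e -> K) u (E : {mpoly K[e]}) :
    [pchar K] =i pred0 -> is_ideal I -> is_ideal (radical I) ->
    restr (tset d e) h = h -> h.@[pt t0 x0] != 0 ->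
    (forall f, (forall i, radical I (xapply (N (s i)) f)) -> I f) ->
    (forall b, exists B, forall i, radical I (xapply (N (s i)) B - h * b i)) ->
    u.@[pt t0 x0] = 1 ->
    (forall f, f.@[pt t0 x0] = 0 -> add_t_ideal (radical I) t0 (u * f)) ->
    Dmq (pt t0 x0) (add_t_ideal I t0) (embx d E) ->
  exists c : 'I_m -> K, E = \sum_i c i *: specialize (N i) (pt t0 x0).
Proof.
move=> K0 iI iP hT hq NI Nsurj uq uP Eq; set q := pt t0 x0.
pose k := \max_i msize (N i); have Nk i : (msize (N i) <= k)%N by apply: leq_bigmax.
pose l := maxn (msize E) k.
have El : (msize E <= l)%N by apply: leq_maxl.
have kl : (k <= l)%N by apply: leq_maxr.
pose X : finType := 'X_{1..e < l}.
pose xm (a : 'I_#|X|) : 'X_{1..e} := bmnm (enum_val a).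
pose V : 'M[K]_(m, #|X|) := \matrix_(i, a) ((N i)@_(xm a)).@[q].
pose v : 'rV[K]_#|X| := \row_a E@_(xm a).
have [/submxP[Y vY]|] := boolP (v <= V)%MS.
  exists (fun i => Y 0 i); apply/mpolyP => a; rewrite raddf_sum /=.
  have [al|al] := ltnP (mdeg a) l.
    have := congr1 (fun M : 'rV_#|X| => M 0 (enum_rank (BMultinom al : X))) vY.
    rewrite !mxE /xm enum_rankK /= => ->; apply: eq_bigr => i _.
    by rewrite !mxE /xm enum_rankK mcoeffZ mcoeff_specialize.
  rewrite memN_msupp_eq0 ?msize_mdeg_ge ?(leq_trans El) // big1 // => i _.
  rewrite mcoeffZ mcoeff_specialize memN_msupp_eq0 ?rmorph0 ?mulr0 //.
  by rewrite msize_mdeg_ge // (leq_trans (Nk i)) // (leq_trans kl).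
rewrite submxE => /matrix0Pn[z [b]]; rewrite (ord1 z) => {z} vb.
(* A cokernel column of [V] not annihilated by [v], read as a prescribed x-jet. *)
pose lam (a : 'X_{1..e}) := \sum_(i | xm i == a) cokermx V i b.
have lamE a : lam (xm a) = cokermx V a b.
  rewrite /lam (bigD1 a) //= big1 ?addr0 // => i /andP[/eqP/val_inj/enum_val_inj ->].
  by rewrite eqxx.
have [f fP] := jets_at_point K0 t0 x0 l lam.
(* Order [k] makes every [N i] send [f'] to a multiple of [u]; order [l] keeps all derivatives at q
   that [E] and the [N i] see. *)
have [f' [f'u f'f]] := cutoff f k l uq.
have sumX (c : 'X_{1..e} -> K) :
    \sum_(a : 'X_{1..e < l}) c a * (mderivm (xmon d a) f').@[q] =
    \sum_a c (xm a) * cokermx V a b.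
  rewrite (big_enum_val (A := X)) /=; apply: eq_bigr => a _.
  have al : (mdeg (xm a) < l)%N by apply: bmdeg.
  by rewrite f'f ?mdeg_xmon // fP // lamE.
have Nf'q i : (xapply (N i) f').@[q] = 0.
  rewrite (@xapplyE _ _ _ _ _ l) ?(leq_trans (Nk i)) // rmorph_sum /=.
  under eq_bigr do rewrite mevalM.
  rewrite (sumX (fun a => ((N i)@_a).@[q])).
  transitivity ((V *m cokermx V) i b); last by rewrite mulmx_coker mxE.
  rewrite mxE; apply: eq_bigr => a _; by congr (_ * _); rewrite mxE.
have [P0 PD PM] := iP.
have /boolp.choice[p pP] : forall i, exists p : {mpoly K[d + e]} * ('I_d -> {mpoly K[d + e]}),
    radical I p.1 /\
    xapply (N (s i)) f' = p.1 + \sum_(j < d) p.2 j * (tvar K e j - (t0 j)%:MP).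
  move=> i; have [w wE] : exists w, xapply (N (s i)) f' = u * w.
    rewrite (xapplyE _ (Nk _)); elim/big_rec: _ => [|a g _ [w ->]].
      by exists 0; rewrite mulr0.
    have [|w' ->] := f'u (xmon d a); first by rewrite mdeg_xmon bmdeg.
    by exists ((N (s i))@_a * w' + w); rewrite mulrDr mulrCA.
  have [|a [c [Pa aE]]] := uP w.
    by have := Nf'q (s i); rewrite wE mevalM uq mul1r.
  by exists (a, c); rewrite wE.
have /boolp.choice[B BP] := fun j => Nsurj (fun i => (p i).2 j).
(* Applying [N (s i)] to each [B j] matches [h] times the coefficient of [t_j - t0_j] modulo the
   radical, so these parts cancel in the image of [g]. *)
pose g := h * f' - \sum_(j < d) (tvar K e j - (t0 j)%:MP) * B j.
have Ig : I g.
  apply: NI => i; rewrite /g xapplyD -mulN1r.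
  have N1T : restr (tset d e) (-1 : {mpoly K[d + e]}) = -1 by rewrite rmorphN1.
  rewrite (xapply_tconst _ _ N1T) mulN1r xapply_sum (xapply_tconst _ _ hT).
  have [Pp ->] := pP i.
  have -> : h * ((p i).1 + \sum_(j < d) (p i).2 j * (tvar K e j - (t0 j)%:MP)) -
      \sum_j xapply (N (s i)) ((tvar K e j - (t0 j)%:MP) * B j) =
      h * (p i).1 - \sum_j (tvar K e j - (t0 j)%:MP) *
        (xapply (N (s i)) (B j) - h * (p i).2 j).
    rewrite mulrDr -addrA; congr (_ + _); rewrite mulr_sumr -!sumrB -sumrN.
    by apply: eq_bigr => j _; rewrite xapply_tconst ?restr_tvarB //; ring.
  apply: idealB => //; first exact: PM.
  by apply: ideal_sum => // j _; apply: PM.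
(* Since h f' = g + (an element of the ideal of t - t0), [E] kills it at q; but the value there is
   h(q) times the nonzero pairing of [E] with the chosen jet. *)
have := Eq (h * f'); rewrite capply_embx => Ehf.
have : (\sum_(a <- msupp E) E@_a *: mderivm (xmon d a) (h * f')).@[q] = 0.
  apply: Ehf; exists g, B; split=> //.
  by rewrite /g -addrA [X in _ + X](_ : _ = 0) ?addr0 // addrC -sumrB big1 // => j _; ring.
rewrite (@sum_msupp_bounded _ _ _ _ l (fun a c => c *: mderivm (xmon d a) (h * f'))) //; last first.
  by move=> a; rewrite scale0r.
rewrite rmorph_sum /=.
under eq_bigr do rewrite mevalZ mderivm_xmon_tconst // mevalM mulrCA.
rewrite -mulr_sumr (sumX (fun a => E@_a)) => /eqP; rewrite mulf_eq0 (negPf hq) /=.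
suff -> : \sum_a E@_(xm a) * cokermx V a b = (v *m cokermx V) 0 b by rewrite (negPf vb).
by rewrite mxE; apply: eq_bigr => a _; congr (_ * _); rewrite mxE.
Qed.

Theorem theorem4p1 (K : closedFieldType) (Kchar0 : [pchar K] =i pred0)
  (d e : nat) (I : {mpoly K[d + e]} -> Prop)
  (Iprim : primary_ideal I) (Idim : krull_dim_eq I d)
  (Itind : t_independent I)
  (m : nat) (N : 'I_m -> xop K d e) (Nmin : minimal_noetherian I N) :
  exists g : {mpoly K[d]}, g != 0 /\
    forall (t0 : 'I_d -> K) (x0 : 'I_e -> K),
      g.@[t0] != 0 -> in_variety I (pt t0 x0) ->
      forall D : {mpoly K[d + e]},
        (exists c : 'I_m -> K,
            D = \sum_(i < m) c i *: embx d (specialize (N i) (pt t0 x0)))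
        <-> Dmq (pt t0 x0) (add_t_ideal I t0) D.
Proof.
have [NI _] := Nmin; have [iI _ _] := Iprim.
have Pp := radical_prime Iprim; have [iP _ _] := Pp.
have [F [pi [piP pif]]] := prime_residue_field Pp.
have mT := dim_max_indep Kchar0 Iprim Idim Itind piP.
have [p [v [g [gT g0 pv]]]] := separators Kchar0 mT.
have [r [s [h [hT h0 sI sS]]]] := noetherian_surjective Kchar0 mT pif NI piP.
have ghT : restr (tset d e) (g * h) = g * h by rewrite rmorphM /= gT hT.
(* [g] keeps the fibre over [t0] reduced at the point; [h] keeps the factor introduced by
   surjectivity invertible there. *)
exists (to_t (g * h)); split.
  apply/eqP => gh0; have := to_tK (g * h); rewrite gh0 comp_mpoly0 ghT => /esym/eqP.
  by rewrite mulf_eq0 (negPf g0) (negPf h0).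
move=> t0 x0; rewrite (to_t_eval _ t0 x0) ghT mevalM mulf_eq0 negb_or => /andP[gq hq] Iq D.
split=> [[c ->]|Dq]; first by apply: specialize_Dmq => // f i /NI; apply.
have [E DE] := embx_of_support (fun a => Dmq_support (m := a) Kchar0 iI Dq).
have Pq f : radical I f -> f.@[pt t0 x0] = 0 by apply: variety_radical.
have [|||u [uq uP]] := @reduced_fibre _ _ _ t0 x0 (radical I) p iP Pq.
- by move=> j; case: (pv j).
- by move=> j; apply/piP; case: (pv j).
(* The difference between [g] and its multiple of the derivative lies in the radical, hence vanishes
   at the point; as [g] does not vanish there, neither does the derivative. *)
- move=> j; have [_ _ E1] := pv j; apply: contraNneq gq => p'0.
  have : (((p j)^`().['X_(rshift d j)] * v j) - g).@[pt t0 x0] = 0.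
    by apply/Pq/piP; rewrite rmorphB E1 subrr.
  by rewrite mevalB mevalM p'0 mul0r sub0r => /eqP; rewrite oppr_eq0.
have [|||||c cE] := @specialization_span _ _ _ I r m s N h t0 x0 u E Kchar0 iI iP hT hq.
- by move=> f fs; apply: sI => i; apply/piP.
- move=> b; have [B BP] := sS b; exists B => i; apply/piP.
  by rewrite rmorphB BP subrr.
- by [].
- by [].
- by rewrite -DE.
by exists c; rewrite DE cE embx_sum.
Qed.
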